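(* There exists a universal constant $C>0$ such that for every $n\in\mathbb N$ and $M>0$ there exists $N=N(n,M)\in\mathbb N$ with the following property. For every linear operator $T: H^1_N(\delta^2)\to H^1_N(\delta^2)$ with $\|T\|\le M$, the identity on $H^1_n(\delta^2)$ factors through $H=T$ or through $H=\mathrm{Id}-T$; that is, for at least one choice $H\in\{T,\mathrm{Id}-T\}$ there exist linear operators $E: H^1_n(\delta^2)\to H^1_N(\delta^2)$ and $P: H^1_N(\delta^2)\to H^1_n(\delta^2)$ such that $$PHE=\mathrm{Id}_{H^1_n(\delta^2)}\qquad\text{and}\qquad \|E\|\,\|P\|\le C.$$
   Context: Dyadic intervals: $\mathscr D=\{[2^{-j}k,2^{-j}(k+1)) : j,k\in\mathbb N_0,\ k\le 2^j-1\}$. Dyadic rectangles: $\mathscr R=\mathscr D\times\mathscr D$, and for $n\in\mathbb N$, $\mathscr R_n=\{I\times J\in\mathscr R: |I|\ge 2^{-n},\ |J|\ge 2^{-n}\}$. For $I\in\mathscr D$ the $L^\infty$-normalized Haar function $h_I$ is $+1$ on the left half of $I$, $-1$ on the right half of $I$, and $0$ elsewhere; $h_{I\times J}(s,t)=h_I(s)h_J(t)$. Scalars are real. The space $H^1(\delta^2)$ is the completion of $\mathrm{span}\{h_{I\times J}: I\times J\in\mathscr R\}$ under the norm $$\Big\|\sum a_{I\times J}h_{I\times J}\Big\|_{H^1(\delta^2)}=\int_0^1\!\int_0^1\Big(\sum a_{I\times J}^2h_{I\times J}^2(s,t)\Big)^{1/2}ds\,dt ,$$ and $H^1_n(\delta^2)=\mathrm{span}\{h_{I\times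 J}: I\times J\in\mathscr R_n\}$ equipped with the norm of $H^1(\delta^2)$. Operator norms refer to these norms. *)

(* Defs.v *)
From HB Require Import structures.
From mathcomp Require Import all_boot all_order all_algebra finmap.
From mathcomp Require Import all_classical all_reals all_analysis.
From mathcomp Require Import zify ring lra.

Set Implicit Arguments.
Unset Strict Implicit.
Unset Printing Implicit Defensive.

Import Order.TTheory GRing.Theory Num.Theory.
Import numFieldNormedType.Exports.

Local Open Scope classical_set_scope.
Local Open Scope ring_scope.

(* The pair (j, k), with k < 2 ^ j, stands for [2^-j k, 2^-j (k + 1)). *)
Definition dyadic := {j : nat & 'I_(2 ^ j)}.

(* (I, J) stands for the rectangle I x J. *)
Definition rect := (dyadic * dyadic)%type.

Section Haar.
Variable R : realType.

Definition dlen (I : dyadic) : R := 2 ^- tag I.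

Definition dinf (I : dyadic) : R := (tagged I)%:R * dlen I.

Definition dmid (I : dyadic) : R := dinf I + dlen I / 2.

Definition dsup (I : dyadic) : R := dinf I + dlen I.

Definition haar (I : dyadic) (x : R) : R :=
  if dinf I <= x < dmid I then 1
  else if dmid I <= x < dsup I then - 1 else 0.

Definition haar2 (Q : rect) (x : R * R) : R := haar Q.1 x.1 * haar Q.2 x.2.

Definition rect_le (n : nat) : {pred rect} :=
  [pred Q | (2 ^- n <= dlen Q.1) && (2 ^- n <= dlen Q.2)].

Definition coefs := {fsfun rect -> R with 0}.

Definition haar_sum (a : coefs) : R * R -> R :=
  \sum_(Q <- finsupp a) a Q *: haar2 Q.

(* The coefficients are unique ([haar_sumK]), so the choice made by [xget]
   is irrelevant; outside the span of the Haar functions the value is 0. *)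
Definition haar_coef (f : R * R -> R) : coefs :=
  xget [fsfun] [set a | haar_sum a = f].

Definition H1norm (f : R * R -> R) : R :=
  let a := haar_coef f in
  \int[lebesgue_measure]_(s in `[0, 1])
    \int[lebesgue_measure]_(t in `[0, 1])
      Num.sqrt (\sum_(Q <- finsupp a) a Q ^+ 2 * haar2 Q (s, t) ^+ 2).

Definition H1_pred (n : nat) : {pred R * R -> R} :=
  mem [set f | exists2 a : coefs,
                 {subset finsupp a <= rect_le n} & haar_sum a = f].

Lemma haar_sum_sub (a : coefs) (S : {fset rect}) :
  {subset finsupp a <= S} -> haar_sum a = \sum_(Q <- S) a Q *: haar2 Q.
Proof.
move=> aS; apply: big_fset_incl; first exact/fsubsetP.
by move=> Q _ Qa; rewrite fsfun_dflt// scale0r.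
Qed.

(* On the points of the grid of mesh 2^-p, a Haar function of level < p. *)
Let haar_grid (I : dyadic) (p m : nat) : (tag I < p)%N ->
  let q := (2 ^ (p - (tag I).+1))%N in let k := nat_of_ord (tagged I) in
  haar I (m%:R / 2 ^+ p) =
    if (k.*2 * q <= m < k.*2.+1 * q)%N then 1
    else if (k.*2.+1 * q <= m < k.*2.+2 * q)%N then - 1 else 0.
Proof.
move=> Ip q k.
have q0 : 0 < 2 ^+ p :> R by rewrite exprn_gt0.
have e0 : 2 ^+ tag I != 0 :> R by rewrite expf_neq0.
have pE : 2 ^+ p = q%:R * 2 * 2 ^+ tag I :> R.
  by rewrite natrX -exprSr -exprD; congr (_ ^+ _); lia.
have n0 : q%:R != 0 :> R by rewrite pnatr_eq0 expn_eq0.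
have D : k.*2%:R = k%:R * 2 :> R by rewrite -muln2 natrM.
have infE : dinf I = (k.*2 * q)%:R / 2 ^+ p.
  rewrite pE /dinf /dlen -/k natrM D; field.
  by rewrite e0 n0.
have midE : dmid I = (k.*2.+1 * q)%:R / 2 ^+ p.
  rewrite pE /dmid /dinf /dlen -/k natrM -[k.*2.+1]addn1 natrD D; field.
  by rewrite e0 n0.
have supE : dsup I = (k.*2.+2 * q)%:R / 2 ^+ p.
  rewrite pE /dsup /dinf /dlen -/k natrM -[k.*2.+2]addn2 natrD D; field.
  by rewrite e0 n0.
by rewrite /haar infE midE supE !ler_pM2r ?ltr_pM2r ?invr_gt0// !ler_nat !ltr_nat.
Qed.

Let lft (I : dyadic) : R := (tagged I).*2%:R / 2 ^+ (tag I).+1.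
Let rgt (I : dyadic) : R := (tagged I).*2.+1%:R / 2 ^+ (tag I).+1.

Let haar_lr (I J : dyadic) : (tag J <= tag I)%N -> J != I ->
  haar J (lft I) = haar J (rgt I).
Proof.
move=> JI nJI; rewrite /lft /rgt !haar_grid//.
set k := nat_of_ord (tagged I); set l := nat_of_ord (tagged J).
move: JI; rewrite leq_eqVlt => /orP[/eqP JI|JI].
  have nkl : l <> k.
    move: nJI JI; rewrite /k /l; case: I {k} => i k; case: J {l} => j l /=.
    move=> /eqP nJI ji; subst j => lk; apply: nJI; congr existT.
    exact/val_inj.
  rewrite JI subnn expn0 !muln1.
  by rewrite ifF ?ifF ?ifF ?ifF//; lia.
have -> : ((tag I).+1 - (tag J).+1 = (tag I - (tag J).+1).+1)%N by lia.
rewrite expnS; set q := (2 ^ _)%N.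
have H (a b c : nat) :
  ((a * (2 * q) <= k.*2 < b * (2 * q)) = (a * (2 * q) <= k.*2.+1 < b * (2 * q)))%N.
  by rewrite !(mulnCA _ 2%N); congr andb; lia.
by rewrite !H.
Qed.

Let haar_free (s : seq dyadic) (c : dyadic -> R) : uniq s ->
  (forall x, \sum_(I <- s) haar I x * c I = 0) -> {in s, forall I, c I = 0}.
Proof.
move=> us sum0.
pose B := (\max_(I <- s) tag I)%N.
have sB I : I \in s -> (tag I <= B)%N by move=> Is; exact: leq_bigmax_seq.
suff H k I : I \in s -> (B - tag I < k)%N -> c I = 0.
  by move=> I Is; apply: (H (B - tag I).+1).
elim: k I => // k IH I Is Ik.
have := congr2 (fun u v : R => u - v) (sum0 (lft I)) (sum0 (rgt I)).
rewrite subrr -sumrB (bigD1_seq I)//= [X in _ + X]big1_seq => [|J].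
  rewrite addr0 /lft /rgt !haar_grid// subnn expn0 !muln1.
  by rewrite !leqnn !ltnn ?andbF/= => cI; lra.
move=> /andP[nJI Js]; have [JI|IJ] := leqP (tag J) (tag I).
  by rewrite haar_lr// subrr.
by rewrite (IH J) ?mulr0 ?subrr//; have := sB _ Js; lia.
Qed.

Lemma haar_sum_inj : injective haar_sum.
Proof.
move=> a b ab; pose S := (finsupp a `|` finsupp b)%fset.
pose d Q := a Q - b Q.
have d0 Q : Q \notin S -> d Q = 0.
  rewrite in_fsetU negb_or => /andP[Qa Qb].
  by rewrite /d !fsfun_dflt// subrr.
pose s1 := undup [seq Q.1 | Q <- S]; pose s2 := undup [seq Q.2 | Q <- S].
have S12 Q : Q \in S -> (Q.1 \in s1) && (Q.2 \in s2).
  by move=> QS; rewrite !mem_undup !map_f.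
pose s12 := [seq (K, L) | K <- s1, L <- s2].
have us12 : uniq s12.
  by apply: allpairs_uniq; rewrite ?undup_uniq// => -[? ?] [? ?].
have dsum x : \sum_(Q <- s12) d Q * haar2 Q x = 0.
  rewrite (bigID [in S])/= [X in _ + X]big1 ?addr0; last first.
    by move=> Q /d0 ->; rewrite mul0r.
  rewrite -big_filter (perm_big (S : seq rect))/=; last first.
    apply: uniq_perm; rewrite ?filter_uniq ?fset_uniq// => Q; rewrite mem_filter.
    apply/andP/idP => [[]//|QS]; split=> //.
    by move: (S12 _ QS); case: Q {QS} => I J /andP[? ?]; apply/allpairsP; exists (I, J).
  have := congr1 (fun f => f x) ab.
  rewrite (@haar_sum_sub a S); last by move=> Q Qa; rewrite in_fsetU Qa.
  rewrite (@haar_sum_sub b S); last by move=> Q Qb; rewrite in_fsetU Qb orbT.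
  rewrite !fct_sumE => /eqP; rewrite -subr_eq0 -sumrB => /eqP sum0.
  rewrite -[RHS]sum0; apply: eq_bigr => Q _; exact: mulrBl.
have d12 I J : I \in s1 -> J \in s2 -> d (I, J) = 0.
  move=> Is Js; apply: (@haar_free s2 (fun J => d (I, J)) (undup_uniq _)) Js => y.
  apply: (@haar_free s1 (fun I => \sum_(J <- s2) haar J y * d (I, J))
    (undup_uniq _)) Is => x.
  rewrite -[RHS](dsum (x, y)) big_allpairs_dep/=; apply: eq_bigr => I' _.
  by rewrite mulr_sumr; apply: eq_bigr => J' _; rewrite /haar2/=; ring.
apply/fsfunP => -[I J]; apply/eqP; rewrite -subr_eq0; apply/eqP.
rewrite -/(d (I, J)).
by have [/S12/andP[? ?]|/d0//] := boolP ((I, J) \in S); exact: d12.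
Qed.

Lemma haar_sumK : cancel haar_sum haar_coef.
Proof.
move=> a; apply: haar_sum_inj; rewrite /haar_coef.
by case: xgetP => [b _ //|/(_ a)]; case.
Qed.

Lemma H1_submod_closed n : submod_closed (H1_pred n).
Proof.
split.
  rewrite inE; exists [fsfun] => [Q|]; first by rewrite finsupp0.
  by rewrite /haar_sum finsupp0 big_seq_fset0.
move=> c f g; rewrite !inE => -[a an <-] [b bn <-].
pose S := (finsupp a `|` finsupp b)%fset.
pose d : coefs := [fsfun Q in S => c * a Q + b Q].
have dE Q : d Q = c * a Q + b Q.
  rewrite fsfunE in_fsetU; case: ifPn => //; rewrite negb_or => /andP[Qa Qb].
  by rewrite !fsfun_dflt// mulr0 addr0.
have dS : {subset finsupp d <= S}.
  by apply/fsubsetP; exact: finsupp_sub.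
exists d.
  by move=> Q /dS; rewrite in_fsetU => /orP[/an|/bn].
rewrite (haar_sum_sub dS) (@haar_sum_sub a S); last first.
  by move=> Q Qa; rewrite in_fsetU Qa.
rewrite (@haar_sum_sub b S); last by move=> Q Qb; rewrite in_fsetU Qb orbT.
rewrite scaler_sumr -big_split/=; apply: eq_bigr => Q _.
by rewrite dE scalerDl scalerA.
Qed.

HB.instance Definition _ n :=
  GRing.isSubmodClosed.Build R (R * R -> R) (H1_pred n) (H1_submod_closed n).

(* H^1_n, as a vector space of functions on the plane that vanish off the
   unit square; its norm is [H1norm] of the underlying function. *)
Record H1 (n : nat) := MkH1 {
  H1_fun :> R * R -> R ;
  H1_funP : H1_fun \in H1_pred n }.

HB.instance Definition _ n := [isSub for @H1_fun n].
HB.instance Definition _ n := [Choice of H1 n by <:].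
HB.instance Definition _ n := [SubChoice_isSubLmodule of H1 n by <:].

(* With values in the extended reals, an unbounded operator has norm +oo. *)
Definition opnorm (m n : nat) (T : H1 m -> H1 n) : \bar R :=
  ereal_sup [set (H1norm (T f))%:E | f in [set f : H1 m | H1norm f <= 1]].

End Haar.

(* Main.v *)
From HB Require Import structures.
Require Import Defs.
From mathcomp Require Import all_boot all_order all_algebra finmap.
From mathcomp Require Import all_classical all_reals all_analysis.
From mathcomp Require Import measurable_realfun.
From mathcomp Require Import zify ring lra.

Set Implicit Arguments.
Unset Strict Implicit.
Unset Printing Implicit Defensive.

Import Order.TTheory GRing.Theory Num.Theory.
Import numFieldNormedType.Exports.

Local Open Scope ring_scope.

(** The identity of H^1_n factors through [T] or through [Id - T] because [T] has a
    compression to an isometric and contractively complemented copy of H^1_n which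
    is close to a multiplier of the Haar basis with all its entries on one side
    of 1/2.

    The copy. Fix levels k_0 < ... < k_n and a sign for every dyadic interval. The
    set of [0, 1) is [0, 1); for an interval I of level i let b_I be the sum of the
    signed Haar functions of the intervals of length 2^-k_i inside the set of I, and
    let {b_I = 1} and {b_I = -1} be the sets of the left and the right half of I. The
    tensor products of b_I and b_J from two such systems, with
    levels k_i and l_j, play the role of the functions h_{IxJ}. The sets of the
    intervals of level n + 1 are the fibres of a measure preserving map [label], and
    the square function of the image of f is that of f composed with these maps, so
    the embedding is isometric ([H1norm_block_emb]). The coefficient at IxJ of the
    orthogonal projection of g is an average of coefficients of g over the block. All
    the intervals in the block of I meet a given fibre inside the set of I in the same
    proportion; therefore the coefficients that enter the square function of the
    projection at a point are averages over one fibre, the same for all I and J, and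
    Minkowski's inequality shows that the projection is a contraction
    ([H1norm_block_prj]).

    Almost diagonal form. Of [T] it is only used that, for fixed Q, the numbers
    <T h_Q, h_Q'> with Q' in one generation have absolute sum at most M|Q|
    ([matrix_row_bound]). If the signs are random, sums over pairs of distinct
    intervals have small second moments by orthogonality ([mean_sq_offdiag]). The
    blocks are random as well, and the sum of diagonal entries over a block is
    close to its expectation, which is |IxJ| times the sum D(k_i, l_j) of the
    diagonal entries over all rectangles with sides 2^-k_i and 2^-l_j
    ([mean_sq_label_avg]). The errors are O(M^2 (2^-k_0 + 2^-l_0)) in the mean square,
    so they can be made as small as desired for a suitable choice of signs
    ([exists_good_signs]), once k_0 and l_0 are large in terms of n and M.

    One side of 1/2. Colour a pair of levels (k, l) by the truth of 1/2 <= D(k, l). A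
    bipartite Ramsey argument ([bipartite_ramsey]) gives n + 1 levels k and n + 1
    levels l on which the colour is constant; the colour decides between [T] and
    [Id - T]. The compression S is then bounded below by 1/4 ([H1norm_lower]), and the
    inverse of S composed with the projection is the left factor of norm at most 4. *)

(** * Dyadic intervals as bit strings *)

(** A word stands for a dyadic interval: its size is the level, and its bits say
    left or right half, the last choice being the head. So [behead] is the passage
    to the parent, and the words of size [p] also serve as the points of the grid
    of mesh 2^-p. *)
Definition word := seq bool.

Fixpoint words (p : nat) : seq word :=
  if p is p'.+1 then flatten [seq [:: false :: u; true :: u] | u <- words p']
  else [:: [::]].

Lemma mem_words p (u : word) : (u \in words p) = (size u == p).
Proof.
elim: p u => [|p IH] [|w u] //=.
  by apply/negbTE/flattenP => -[s /mapP[v _ ->]]; rewrite !inE.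
rewrite eqSS -IH; apply/flattenP/idP => [[s /mapP[v vp ->]]|up].
  by rewrite !inE => /orP[]/eqP[_ ->].
exists [:: false :: u; true :: u]; first exact: map_f.
by case: w; rewrite !inE eqxx ?orbT.
Qed.

Lemma size_mem_words p u : u \in words p -> size u = p.
Proof. by rewrite mem_words => /eqP. Qed.

Lemma words_uniq p : uniq (words p).
Proof.
elim: p => //= p; elim: (words p) => //= u s IH /andP[us us'].
rewrite !inE eqseq_cons/= IH// andbT.
have H w : (w :: u) \notin flatten [seq [:: false :: v; true :: v] | v <- s].
  apply: contra us => /flattenP[_ /mapP[v vs ->]].
  by rewrite !inE => /orP[]/eqP[_ ->].
by rewrite !H.
Qed.

Lemma size_words p : size (words p) = (2 ^ p)%N.
Proof.
elim: p => //= p; rewrite expnS => <-.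
by elim: (words p) => //= u s ->; lia.
Qed.

Section sums.
Variable V : nmodType.
Implicit Type F : word -> V.

Lemma sum_words0 F : \sum_(u <- words 0) F u = F [::].
Proof. by rewrite big_seq1. Qed.

Lemma sum_wordsS p F :
  \sum_(u <- words p.+1) F u = \sum_(u <- words p) (F (false :: u) + F (true :: u)).
Proof.
rewrite big_flatten big_map; apply: eq_bigr => u _.
by rewrite !big_cons big_nil Monoid.mulm1.
Qed.

Lemma sum_pick (s : seq word) F v : uniq s -> v \in s ->
  \sum_(u <- s) (if u == v then F u else 0) = F v.
Proof.
move=> us vs; rewrite (bigD1_seq v)//= eqxx big1 ?Monoid.mulm1// => u.
by move=> /negbTE ->.
Qed.

Lemma sum_words_pick p F v : size v = p ->
  \sum_(u <- words p) (if u == v then F u else 0) = F v.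
Proof. by move=> vp; rewrite sum_pick ?words_uniq// mem_words vp. Qed.

End sums.

Definition wordsle (n : nat) : seq word := flatten [seq words k | k <- iota 0 n.+1].

Arguments wordsle : simpl never.

Lemma mem_wordsle n (u : word) : (u \in wordsle n) = (size u <= n)%N.
Proof.
apply/flatten_mapP/idP => [[k]|un].
  by rewrite mem_iota mem_words => kn /eqP ->; lia.
by exists (size u); rewrite ?mem_words ?eqxx// mem_iota; lia.
Qed.

Lemma sum_wordsle (V : nmodType) n (F : word -> V) :
  \sum_(u <- wordsle n) F u = \sum_(k < n.+1) \sum_(u <- words k) F u.
Proof. by rewrite big_flatten big_map -{1}[n.+1]subn0 -/(index_iota 0 n.+1) big_mkord. Qed.

Lemma wordsle_uniq n : uniq (wordsle n).
Proof.
rewrite /wordsle; have := iota_uniq 0 n.+1.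
elim: (iota _ _) => //= k s IH /andP[ks /IH {}IH].
rewrite cat_uniq words_uniq IH andbT/=; apply/hasPn => u /flatten_mapP[j js].
rewrite !mem_words => /eqP ->; apply: contraNN ks => /eqP <-.
exact: js.
Qed.

Lemma sum_wordsle_pick (V : nmodType) n (F : word -> V) v : (size v <= n)%N ->
  \sum_(u <- wordsle n) (if u == v then F u else 0) = F v.
Proof. by move=> vn; rewrite sum_pick ?wordsle_uniq// mem_wordsle. Qed.

(** The interval of level [k] that contains the interval [x]. *)
Definition anc (k : nat) (x : word) : word := drop (size x - k) x.

Lemma size_anc k x : (k <= size x)%N -> size (anc k x) = k.
Proof. by move=> kx; rewrite size_drop subKn. Qed.

Lemma anc_id x : anc (size x) x = x.
Proof. by rewrite /anc subnn drop0. Qed.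

Lemma anc_size p x : size x = p -> anc p x = x.
Proof. by move=> <-; exact: anc_id. Qed.

Lemma anc_cons k w x : (k <= size x)%N -> anc k (w :: x) = anc k x.
Proof. by move=> kx; rewrite /anc /= subSn. Qed.

Lemma anc_anc j k x : (j <= k <= size x)%N -> anc j (anc k x) = anc j x.
Proof.
move=> /andP[jk kx]; rewrite /anc drop_drop; congr drop.
by rewrite size_drop; lia.
Qed.

Lemma sum_anc (R : nzRingType) p k (g : word -> R) : (k <= p)%N ->
  \sum_(x <- words p) g (anc k x) = 2 ^+ (p - k) * \sum_(u <- words k) g u.
Proof.
elim: p => [|p IH].
  by rewrite leqn0 => /eqP ->; rewrite mul1r !sum_words0.
rewrite leq_eqVlt => /orP[/eqP ->|kp].
  rewrite subnn mul1r; apply: eq_big_seq => x /size_mem_words <-.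
  by rewrite anc_id.
rewrite sum_wordsS subSn// exprS -mulrA -IH// mulr_sumr.
apply: eq_big_seq => x /size_mem_words xp.
by rewrite !anc_cons ?xp// mulr_natl.
Qed.

Lemma ler_sum_seq (R : numDomainType) (T : eqType) (s : seq T) (F G : T -> R) :
  (forall i, i \in s -> F i <= G i) -> \sum_(i <- s) F i <= \sum_(i <- s) G i.
Proof. by move=> FG; rewrite big_seq [leRHS]big_seq; exact: ler_sum. Qed.

(** * Haar coefficients indexed by bit strings *)

Definition word_val (u : word) : nat := foldr (fun (w : bool) m => (w + m.*2)%N) 0%N u.

Lemma word_val_lt u : (word_val u < 2 ^ size u)%N.
Proof. by elim: u => //= w u; rewrite expnS; case: w => /=; lia. Qed.

Definition word_dyadic (u : word) : dyadic :=
  existT (fun j => 'I_(2 ^ j)) (size u) (Ordinal (word_val_lt u)).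

Fixpoint val_word (j m : nat) : word :=
  if j is j'.+1 then odd m :: val_word j' m./2 else [::].

Definition dyadic_word (I : dyadic) : word := val_word (tag I) (tagged I).

Lemma size_val_word j m : size (val_word j m) = j.
Proof. by elim: j m => //= j IH m; rewrite IH. Qed.

Lemma word_valK u : val_word (size u) (word_val u) = u.
Proof.
elim: u => //= w u IH; rewrite oddD odd_double addbF oddb.
by rewrite halfD odd_double andbF add0n half_double; case: w; rewrite /= add0n IH.
Qed.

Lemma val_wordK j m : (m < 2 ^ j)%N -> word_val (val_word j m) = m.
Proof.
elim: j m => [|j IH] m /=; first by rewrite expn0; case: m.
by rewrite expnS => mj; rewrite IH ?odd_double_half//; lia.
Qed.

Lemma dyadic_eq (I J : dyadic) :
  tag I = tag J -> tagged I = tagged J :> nat -> I = J.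
Proof.
case: I J => [i k] [j l] /= ij; subst j => kl; congr existT; exact: val_inj.
Qed.

Lemma word_dyadicK : cancel word_dyadic dyadic_word.
Proof. by move=> u; rewrite /dyadic_word /= word_valK. Qed.

Lemma dyadic_wordK : cancel dyadic_word word_dyadic.
Proof.
move=> I; apply: dyadic_eq; rewrite /= ?size_val_word//.
by rewrite val_wordK//; exact: ltn_ord.
Qed.

Lemma size_dyadic_word I : size (dyadic_word I) = tag I.
Proof. exact: size_val_word. Qed.

Section Bridge.
Variable R : realType.
Implicit Types (a : coefs R) (c : word -> word -> R).

Lemma rect_leE n (Q : rect) : rect_le R n Q = (tag Q.1 <= n)%N && (tag Q.2 <= n)%N.
Proof.
have H (I : dyadic) : (2 ^- n <= dlen R I) = (tag I <= n)%N.
  by rewrite /dlen lef_pV2 ?posrE ?exprn_gt0// ler_eXn2l// ltr1n.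
by rewrite /rect_le inE/= !H.
Qed.

Definition rects n : {fset rect} :=
  seq_fset tt [seq (word_dyadic u, word_dyadic v) | u <- wordsle n, v <- wordsle n].

Lemma mem_rects n Q : (Q \in rects n) = (tag Q.1 <= n)%N && (tag Q.2 <= n)%N.
Proof.
rewrite seq_fsetE; apply/allpairsP/andP => [[[u v]/= [un vn ->]]|[Q1 Q2]].
  by rewrite -!mem_wordsle.
exists (dyadic_word Q.1, dyadic_word Q.2); rewrite /= !mem_wordsle !size_dyadic_word !dyadic_wordK; split=> //.
exact: surjective_pairing.
Qed.

Lemma sum_finsupp (V : nmodType) a n (F : rect -> V) :
  {subset finsupp a <= rect_le R n} -> (forall Q, a Q = 0 -> F Q = 0) ->
  \sum_(Q <- finsupp a) F Q =
  \sum_(u <- wordsle n) \sum_(v <- wordsle n) F (word_dyadic u, word_dyadic v).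
Proof.
move=> an F0.
pose L := [seq (word_dyadic u, word_dyadic v) | u <- wordsle n, v <- wordsle n].
transitivity (\sum_(Q <- L) F Q); last by rewrite big_allpairs_dep.
have uL : uniq L.
  apply: allpairs_uniq; rewrite ?wordsle_uniq// => -[u v] [u' v'] _ _ /= H.
  have H1 := congr1 (fun Q : rect => dyadic_word Q.1) H.
  have H2 := congr1 (fun Q : rect => dyadic_word Q.2) H.
  by rewrite /= !word_dyadicK in H1 H2; rewrite H1 H2.
rewrite [RHS](bigID [in finsupp a])/= [X in _ = _ + X]big1 ?addr0; last first.
  by move=> Q Qa; rewrite F0// fsfun_dflt.
rewrite -[RHS]big_filter; apply: perm_big; apply: uniq_perm.
- exact: fset_uniq.
- exact: filter_uniq.
move=> Q; rewrite mem_filter; apply/idP/andP => [Qa|[]//]; split=> //.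
have := an _ Qa; rewrite /in_mem/= -/(rect_le R n Q) rect_leE -mem_rects seq_fsetE; exact.
Qed.

Definition hcoef (f : R * R -> R) (u v : word) : R :=
  haar_coef f (word_dyadic u, word_dyadic v).

Lemma finsupp_haar_coef n (f : H1 R n) : {subset finsupp (haar_coef f) <= rect_le R n}.
Proof. by case: f => f /=; rewrite inE => -[a an <-]; rewrite haar_sumK. Qed.

Lemma haar_coefK n (f : H1 R n) : haar_sum (haar_coef f) = f.
Proof. by case: f => f /=; rewrite inE => -[a an <-]; rewrite haar_sumK. Qed.

Lemma haar_coef_lin n k (f g : H1 R n) Q :
  haar_coef (k *: f + g : H1 R n) Q = k * haar_coef f Q + haar_coef g Q.
Proof.
set a := haar_coef f; set b := haar_coef g.
pose S := (finsupp a `|` finsupp b)%fset.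
pose d : coefs R := [fsfun Q in S => k * a Q + b Q].
have dE Q' : d Q' = k * a Q' + b Q'.
  rewrite fsfunE in_fsetU; case: ifPn => //; rewrite negb_or => /andP[Qa Qb].
  by rewrite !fsfun_dflt// mulr0 addr0.
rewrite -dE; suff -> : H1_fun (k *: f + g) = haar_sum d by rewrite haar_sumK.
have dS : {subset finsupp d <= S} by apply/fsubsetP; exact: finsupp_sub.
transitivity (k *: H1_fun f + H1_fun g) => //.
rewrite -(haar_coefK f) -(haar_coefK g) -/a -/b.
rewrite (haar_sum_sub dS) (@haar_sum_sub _ a S); last first.
  by move=> Q' Qa; rewrite in_fsetU Qa.
rewrite (@haar_sum_sub _ b S); last by move=> Q' Qb; rewrite in_fsetU Qb orbT.
rewrite scaler_sumr -big_split/=; apply: eq_bigr => Q' _.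
by rewrite dE scalerDl scalerA.
Qed.

Lemma hcoef_lin n k (f g : H1 R n) u v :
  hcoef (k *: f + g : H1 R n) u v = k * hcoef f u v + hcoef g u v.
Proof. exact: haar_coef_lin. Qed.

Lemma hcoef0 n u v : hcoef (0 : H1 R n) u v = 0.
Proof.
by have := hcoef_lin 1 (0 : H1 R n) 0 u v; rewrite scaler0 addr0 mul1r => H; lra.
Qed.

Lemma hcoefD n (f g : H1 R n) u v :
  hcoef (f + g : H1 R n) u v = hcoef f u v + hcoef g u v.
Proof. by rewrite -[f in LHS]scale1r hcoef_lin mul1r. Qed.

Lemma hcoefZ n k (f : H1 R n) u v : hcoef (k *: f : H1 R n) u v = k * hcoef f u v.
Proof. by rewrite -[k *: f]addr0 hcoef_lin hcoef0 addr0. Qed.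

Lemma hcoefB n (f g : H1 R n) u v :
  hcoef (f - g : H1 R n) u v = hcoef f u v - hcoef g u v.
Proof. by rewrite -scaleN1r addrC hcoef_lin mulN1r addrC. Qed.

Lemma hcoef_sum n (T : Type) (s : seq T) (F : T -> H1 R n) u v :
  hcoef (\sum_(i <- s) F i : H1 R n) u v = \sum_(i <- s) hcoef (F i) u v.
Proof. by elim: s => [|i s IH]; rewrite ?big_nil ?big_cons ?hcoef0// hcoefD IH. Qed.

Lemma hcoef_out n (f : H1 R n) u v :
  ~~ ((size u <= n)%N && (size v <= n)%N) -> hcoef f u v = 0.
Proof.
move=> uv; apply: fsfun_dflt; apply: contra uv => /(@finsupp_haar_coef n f).
by rewrite /in_mem/= -/(rect_le R n _) rect_leE.
Qed.

(** Identities between elements and between operators are proved through this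
    lemma, coefficient by coefficient. *)
Lemma hcoef_ext n (f g : H1 R n) :
  (forall u v, (size u <= n)%N -> (size v <= n)%N -> hcoef f u v = hcoef g u v) -> f = g.
Proof.
move=> fg; apply: val_inj; rewrite /= -(haar_coefK f) -(haar_coefK g); congr haar_sum.
apply/fsfunP => -[I J]; rewrite -(dyadic_wordK I) -(dyadic_wordK J) -/(hcoef f _ _) -/(hcoef g _ _).
have [/andP[uu vv]|uv] := boolP ((size (dyadic_word I) <= n)%N && (size (dyadic_word J) <= n)%N).
  exact: fg.
by rewrite !hcoef_out.
Qed.

Definition restrict_coefs n c : coefs R :=
  [fsfun Q in rects n => c (dyadic_word Q.1) (dyadic_word Q.2)].

Lemma of_coefs_subproof n c : haar_sum (restrict_coefs n c) \in H1_pred n.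
Proof.
rewrite inE; exists (restrict_coefs n c) => // Q Qc.
rewrite /in_mem/= -/(rect_le R n Q) rect_leE -mem_rects.
by move: Q Qc; apply/fsubsetP; exact: finsupp_sub.
Qed.

Definition of_coefs n c : H1 R n := MkH1 (of_coefs_subproof n c).

Lemma hcoef_of_coefs n c u v : (size u <= n)%N -> (size v <= n)%N ->
  hcoef (of_coefs n c) u v = c u v.
Proof.
move=> un vn; rewrite /hcoef /= haar_sumK fsfunE mem_rects/= un vn/=.
by rewrite !word_dyadicK.
Qed.

Lemma of_coefs_lin n k c d (f : word -> word -> R) :
  (forall u v, f u v = k * c u v + d u v) -> of_coefs n f = k *: of_coefs n c + of_coefs n d.
Proof. by move=> fE; apply: hcoef_ext => u v un vn; rewrite hcoef_lin !hcoef_of_coefs. Qed.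

Definition haar_elt n (u v : word) : H1 R n :=
  of_coefs n (fun u' v' => ((u' == u) && (v' == v))%:R).

Lemma H1_haar_decomp n (f : H1 R n) :
  f = \sum_(u <- wordsle n) \sum_(v <- wordsle n) hcoef f u v *: haar_elt n u v.
Proof.
apply: hcoef_ext => u v un vn; rewrite hcoef_sum.
rewrite -[LHS](@sum_wordsle_pick _ n (fun u' => hcoef f u' v))//; apply: eq_bigr => u' _.
rewrite hcoef_sum; case: eqP => [->|uu'].
  rewrite -[LHS](@sum_wordsle_pick _ n (fun v' => hcoef f u v'))//; apply: eq_bigr => v' _.
  rewrite hcoefZ hcoef_of_coefs// eqxx eq_sym; case: eqP => _; first by rewrite mulr1.
  by rewrite mulr0.
rewrite big1// => v' _; rewrite hcoefZ hcoef_of_coefs//.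
by rewrite eq_sym; move/eqP/negbTE: uu' => ->; rewrite mulr0.
Qed.

Lemma hcoef_linear m n (T : {linear H1 R m -> H1 R n}) f u' v' :
  hcoef (T f) u' v' =
  \sum_(u <- wordsle m) \sum_(v <- wordsle m) hcoef f u v * hcoef (T (haar_elt m u v)) u' v'.
Proof.
rewrite {1}(H1_haar_decomp f) linear_sum hcoef_sum; apply: eq_bigr => u _.
rewrite linear_sum hcoef_sum; apply: eq_bigr => v _.
by rewrite linearZ hcoefZ.
Qed.

End Bridge.

(** * The norm as an average over a dyadic grid *)

Section Norm.
Variable R : realType.

Definition in_cell (u : word) (s : R) : bool :=
  (dinf R (word_dyadic u) <= s) && (s < dsup R (word_dyadic u)).

Lemma haar_sq I (s : R) : haar I s ^+ 2 = (in_cell (dyadic_word I) s)%:R.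
Proof.
rewrite /in_cell dyadic_wordK /haar.
have H : dinf R I < dmid R I < dsup R I.
  have : 0 < dlen R I by rewrite invr_gt0 exprn_gt0.
  by rewrite /dmid /dsup; lra.
move: H => /andP[H1 H2].
case: (lerP (dinf R I) s) => /= h1; last first.
  case: (lerP (dmid R I) s) => /= h2; last by rewrite expr0n.
  by have := lt_trans (lt_le_trans H1 h2) h1; rewrite ltxx.
case: (ltrP s (dmid R I)) => /= h2; first by rewrite (lt_trans h2 H2) expr1n.
by case: (s < dsup R I); rewrite ?sqrrN ?expr1n ?expr0n.
Qed.

Lemma in_cell_nil s : in_cell [::] s = (0 <= s < 1).
Proof. by rewrite /in_cell /dsup /dinf /dlen /= expr0 invr1 mul0r add0r. Qed.

Lemma dinf_cons w u :
  dinf R (word_dyadic (w :: u)) = dinf R (word_dyadic u) + w%:R * 2 ^- (size u).+1.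
Proof.
rewrite /dinf /dlen /= natrD -muln2 natrM exprS.
have : 2 ^+ size u != 0 :> R by rewrite expf_neq0.
by move=> ?; field.
Qed.

Lemma dsupE u : dsup R (word_dyadic u) = dinf R (word_dyadic u) + 2 ^- size u.
Proof. by []. Qed.

Lemma in_cell_sub w u s : in_cell (w :: u) s -> in_cell u s.
Proof.
rewrite /in_cell !dsupE dinf_cons /=.
have -> : 2 ^- (size u) = 2 * 2 ^- (size u).+1 :> R.
  by rewrite exprS; field; rewrite expf_neq0.
have : 0 < 2 ^- (size u).+1 :> R by rewrite invr_gt0 exprn_gt0.
by case: w => /=; lra.
Qed.

(** The bit [w] tells on which side of the midpoint [s] lies. *)
Lemma in_cell_split u s : in_cell u s ->
  exists w, forall w', in_cell (w' :: u) s = (w' == w).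
Proof.
rewrite /in_cell dsupE.
have -> : 2 ^- (size u) = 2 * 2 ^- (size u).+1 :> R.
  by rewrite exprS; field; rewrite expf_neq0.
move=> su; exists (dinf R (word_dyadic u) + 2 ^- (size u).+1 <= s).
have : 0 < 2 ^- (size u).+1 :> R by rewrite invr_gt0 exprn_gt0.
move=> q0 w'; rewrite !dsupE !dinf_cons /=.
by case: w' => /=; apply/idP/eqP; lra.
Qed.

Lemma in_cell_unit u s : in_cell u s -> 0 <= s < 1.
Proof. by rewrite -in_cell_nil; elim: u => // w u IH /in_cell_sub. Qed.

(** A point of the unit interval is replaced by its cell [x] of level [p]; the
    intervals of level at most [p] that contain it are the ancestors of [x]. *)
Lemma locate p s : 0 <= s < 1 -> exists2 x, size x = p &
  forall u, (size u <= p)%N -> in_cell u s = (u == anc (size u) x).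
Proof.
move=> s01; elim: p => [|p [x xp IH]].
  by exists [::] => // -[]// _; rewrite in_cell_nil s01.
have [w Hw] : exists w, forall w', in_cell (w' :: x) s = (w' == w).
  by apply: in_cell_split; rewrite IH xp// -xp anc_id.
exists (w :: x) => [/=|[|w' u] /=]; first by rewrite xp.
  by rewrite in_cell_nil s01 /anc subn0 drop_oversize.
rewrite ltnS leq_eqVlt => /orP[/eqP up|up]; last first.
  by rewrite IH// anc_cons ?xp.
have -> : anc (size u).+1 (w :: x) = w :: x by rewrite up -xp; exact: (anc_id (w :: x)).
rewrite eqseq_cons; case: (u =P x) => [->|ux]; first by rewrite Hw andbT.
rewrite andbF; apply/negP => /in_cell_sub; rewrite IH ?up// -xp anc_id.
by move=> /eqP.
Qed.

Lemma lebesgue_cell u :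
  lebesgue_measure `[dinf R (word_dyadic u), dsup R (word_dyadic u)[%classic =
  (2 ^- size u)%:E.
Proof.
rewrite lebesgue_measure_itv/= lte_fin dsupE ltrDl invr_gt0 exprn_gt0//.
by rewrite -EFinB addrAC subrr add0r.
Qed.

Lemma cell_sub u : (`[dinf R (word_dyadic u), dsup R (word_dyadic u)[ `<=` `[0, 1])%classic.
Proof.
move=> s /=; rewrite !in_itv/= => us; by have /andP[-> /ltW] := @in_cell_unit u s us.
Qed.

Lemma int_cells p (c : word -> R) : (forall x, 0 <= c x) ->
  (\int[lebesgue_measure]_(s in `[0%R, 1%R])
    (\sum_(x <- words p) c x * (in_cell x s)%:R))%R = 2 ^- p * \sum_(x <- words p) c x.
Proof.
move=> c0; rewrite /Rintegral.
pose I (x : word) : set R := `[dinf R (word_dyadic x), dsup R (word_dyadic x)[%classic.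
have E s : ((\sum_(x <- words p) c x * (in_cell x s)%:R)%:E =
    \sum_(x <- words p) (c x)%:E * (\1_(I x) s)%:E)%E.
  rewrite -sumEFin; apply: eq_bigr => x _.
  by rewrite EFinM indicE /I mem_setE in_itv.
under eq_integral do rewrite E.
rewrite ge0_integral_sum//; last first.
- by move=> x s _; rewrite mule_ge0// lee_fin.
- move=> x; apply: measurable_funeM; apply/measurable_EFinP.
  by apply: measurable_indic; exact: measurable_itv.
have -> : (\sum_(x <- words p) \int[lebesgue_measure]_(s in `[0%R, 1%R])
   ((c x)%:E * (\1_(I x) s)%:E) = \sum_(x <- words p) (2 ^- p * c x)%:E)%E.
  apply: eq_big_seq => x /size_mem_words xp.
  rewrite ge0_integralZl//; last 2 first.
  - by apply/measurable_EFinP; by apply: measurable_indic; exact: measurable_itv.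
  - by rewrite lee_fin.
  rewrite integral_indic//; last exact: measurable_itv.
  rewrite (setIidl (@cell_sub x)).
  transitivity ((c x)%:E * (2 ^- size x)%:E)%E.
    by congr (_ * _)%E; exact: lebesgue_cell.
  by rewrite xp -EFinM mulrC.
by rewrite sumEFin /= -mulr_sumr.
Qed.

(** Of the intervals of level [i] only [anc i x] contains the grid point [x], so
    this is the square function of the Haar sum with coefficients [c]. *)
Definition square_fun (n : nat) (c : word -> word -> R) (x y : word) : R :=
  Num.sqrt (\sum_(i < n.+1) \sum_(j < n.+1) c (anc i x) (anc j y) ^+ 2).

Lemma sum_in_cell n p (F : word -> R) s x : size x = p -> (n <= p)%N ->
  (forall u, (size u <= p)%N -> in_cell u s = (u == anc (size u) x)) ->
  \sum_(u <- wordsle n) F u * (in_cell u s)%:R = \sum_(i < n.+1) F (anc i x).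
Proof.
move=> xp np H; rewrite sum_wordsle; apply: eq_bigr => i _.
have ip : (i <= p)%N by have := ltn_ord i; lia.
rewrite -[RHS](@sum_words_pick _ i) ?size_anc ?xp//.
apply: eq_big_seq => u /size_mem_words ui; rewrite H ui//.
by case: eqP => _; rewrite ?mulr1 ?mulr0.
Qed.

Lemma sqrt_cells n p (f : H1 R n) (s t : R) : (n <= p)%N ->
  Num.sqrt (\sum_(Q <- finsupp (haar_coef f)) haar_coef f Q ^+ 2 * haar2 Q (s, t) ^+ 2) =
  \sum_(y <- words p)
    (\sum_(x <- words p) square_fun n (hcoef f) x y * (in_cell x s)%:R) * (in_cell y t)%:R.
Proof.
move=> np.
rewrite (sum_finsupp (@finsupp_haar_coef _ _ f)); last by move=> Q ->; rewrite expr0n mul0r.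
have E : \sum_(u <- wordsle n) \sum_(v <- wordsle n)
     haar_coef f (word_dyadic u, word_dyadic v) ^+ 2 * haar2 (word_dyadic u, word_dyadic v) (s, t) ^+ 2 =
   \sum_(u <- wordsle n)
     (\sum_(v <- wordsle n) hcoef f u v ^+ 2 * (in_cell v t)%:R) * (in_cell u s)%:R.
  apply: eq_bigr => u _; rewrite mulr_suml; apply: eq_bigr => v _.
  by rewrite /haar2 /= exprMn !haar_sq !word_dyadicK -mulrA [X in _ * X]mulrC.
rewrite E.
have [s01|sN] := boolP (0 <= s < 1); last first.
  have sF u : in_cell u s = false by apply: contraNF sN; exact: in_cell_unit.
  rewrite big1 ?sqrtr0; last by move=> u _; rewrite sF mulr0.
  rewrite big1// => y _; rewrite big1 ?mul0r// => x _.
  by rewrite sF mulr0.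
have [t01|tN] := boolP (0 <= t < 1); last first.
  have tF u : in_cell u t = false by apply: contraNF tN; exact: in_cell_unit.
  rewrite big1 ?sqrtr0; last first.
    by move=> u _; rewrite big1 ?mul0r// => v _; rewrite tF mulr0.
  by rewrite big1// => y _; rewrite tF mulr0.
have [x xp Hx] := locate p s01; have [y yp Hy] := locate p t01.
rewrite (sum_in_cell _ xp np Hx).
transitivity (square_fun n (hcoef f) x y).
  congr Num.sqrt; apply: eq_bigr => i _.
  exact: (sum_in_cell (fun v => hcoef f (anc i x) v ^+ 2) yp np Hy).
rewrite -[LHS](@sum_words_pick _ p (fun y' => square_fun n (hcoef f) x y')) //.
apply: eq_big_seq => y' /size_mem_words yp'.
rewrite Hy ?yp'// (anc_size yp); case: eqP => _; last by rewrite mulr0.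
rewrite mulr1 -[LHS](@sum_words_pick _ p (fun x' => square_fun n (hcoef f) x' y')) //.
apply: eq_big_seq => x' /size_mem_words xp'.
by rewrite Hx ?xp'// (anc_size xp); case: eqP => _; rewrite ?mulr0 ?mulr1.
Qed.

Lemma square_fun_ge0 n c x y : 0 <= square_fun n c x y.
Proof. exact: sqrtr_ge0. Qed.

Definition grid_avg p (F : word -> word -> R) : R :=
  2 ^- p * \sum_(x <- words p) (2 ^- p * \sum_(y <- words p) F x y).

(** The square function of an element of level at most [n] is constant on the
    cells of the grid, and vanishes off the half-open unit square, so the double
    integral is a finite average. From here on no integral occurs. *)
Lemma H1norm_grid_avg n p (f : H1 R n) : (n <= p)%N ->
  H1norm f = grid_avg p (square_fun n (hcoef f)).
Proof.
move=> np; rewrite /H1norm /grid_avg.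
under eq_Rintegral => s _.
  under eq_Rintegral => t _ do rewrite (sqrt_cells _ _ _ np).
  rewrite int_cells; last first.
    by move=> y; apply: sumr_ge0 => x _; rewrite mulr_ge0 ?square_fun_ge0.
  rewrite exchange_big/= mulr_sumr.
  under eq_bigr do rewrite -mulr_suml mulrA.
  over.
rewrite int_cells// => x; rewrite mulr_ge0 ?invr_ge0 ?exprn_ge0//.
by apply: sumr_ge0 => y _; exact: square_fun_ge0.
Qed.

End Norm.

(** * Relabelling the points by signed bits *)

Section Fold.
Variables (A : seq nat) (eps : word -> bool).

(** The bits of [x] at the levels of [A], each flipped by the sign of the interval
    in which the choice takes place. If b_I is built with the signs [eps], then
    reading the values of b on the chain of blocks that contain [x] gives [label x]:
    an interval [K] with level in [A] is part of the block b_I exactly when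
    [label K = I]. *)
Fixpoint label (x : word) : word :=
  if x is w :: u then
    if size u \in A then (w (+) eps u) :: label u else label u
  else [::].

(** The level of [label x] when [x] has level [p]. *)
Definition depth (p : nat) : nat := count (fun a => (a < p)%N) A.

Hypothesis uA : uniq A.

Lemma depthS p : depth p.+1 = ((p \in A) + depth p)%N.
Proof.
rewrite /depth -(count_uniq_mem p uA) -count_predUI -[LHS]addn0; congr addn.
  by apply: eq_count => a /=; rewrite ltnS leq_eqVlt.
by rewrite (eq_count (a2 := pred0)) ?count_pred0// => a /=; lia.
Qed.

Lemma depth0 : depth 0 = 0%N.
Proof. by rewrite /depth (eq_count (a2 := pred0)) ?count_pred0. Qed.

Lemma size_label x : size (label x) = depth (size x).
Proof.
elim: x => [|w x IH] /=; first by rewrite depth0.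
by rewrite depthS; case: (_ \in A); rewrite /= IH.
Qed.

Lemma leq_depth j k : (j <= k)%N -> (depth j <= depth k)%N.
Proof. by move=> jk; apply: sub_count => a /= /leq_trans; apply. Qed.

(** The label map sends chains of intervals to chains. *)
Lemma label_anc k x : (k <= size x)%N -> label (anc k x) = anc (depth k) (label x).
Proof.
elim: x => [|w x IH] /=; first by rewrite leqn0 => /eqP ->.
rewrite leq_eqVlt => /orP[/eqP ->|kx].
  by rewrite anc_size// [RHS]anc_size//; exact: (size_label (w :: x)).
rewrite anc_cons// IH//; case: ifP => // _; rewrite anc_cons// size_label.
exact: leq_depth.
Qed.

Variable R : realFieldType.

(** At a level of [A] exactly one child of each interval has the right new bit;
    at the other levels both children keep the label of their parent. *)
Lemma sum_label_step p y (g : word -> R) :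
  \sum_(x <- words p.+1 | label x == y) g (behead x) =
  if p \in A then
    if y is _ :: y' then \sum_(x <- words p | label x == y') g x else 0
  else 2 * \sum_(x <- words p | label x == y) g x.
Proof.
rewrite [LHS]big_mkcond sum_wordsS.
case: ifP => pA.
  case: y => [|w y].
    by apply: big1_seq => x /andP[_ /size_mem_words xp] /=; rewrite xp pA addr0.
  rewrite [RHS]big_mkcond; apply: eq_big_seq => x /size_mem_words xp /=.
  rewrite xp pA !eqseq_cons; case: (label x == y); rewrite ?andbF ?addr0// !andbT.
  by case: (eps x); case: w; rewrite ?addr0 ?add0r.
rewrite mulr_sumr [RHS]big_mkcond; apply: eq_big_seq => x /size_mem_words xp /=.
by rewrite xp pA; case: ifP; rewrite ?addr0// mulr2n mulrDl mul1r.
Qed.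

(** Homogeneity: the average of [g (anc k x)] over the points [x] with label [y] is
    the average of [g] over the intervals of level [k] that carry the block of the
    corresponding ancestor of [y]. All these intervals contain the same number of
    points with label [y], since each passage to a lower level halves the set or
    keeps it. *)
Lemma sum_label_anc p k y (g : word -> R) : (k <= p)%N -> size y = depth p ->
  2 ^+ depth p / 2 ^+ p * \sum_(x <- words p | label x == y) g (anc k x) =
  2 ^+ depth k / 2 ^+ k * \sum_(u <- words k | label u == anc (depth k) y) g u.
Proof.
have n0 j : 2 ^+ j != 0 :> R by rewrite expf_neq0// pnatr_eq0.
move=> kp ys; have [k' kE] : exists k', (p = k' + k)%N by exists (p - k)%N; lia.
elim: k' p y kE {kp} ys => [|k' IH] p y -> ys.
  congr (_ * _); rewrite add0n big_seq_cond [RHS]big_seq_cond (anc_size ys).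
  by apply: eq_bigr => x /andP[/size_mem_words xk _]; rewrite (anc_size xk).
pose q := (k' + k)%N; rewrite -/q in ys *.
have -> : \sum_(x <- words q.+1 | label x == y) g (anc k x) =
    \sum_(x <- words q.+1 | label x == y) g (anc k (behead x)).
  rewrite big_seq_cond [RHS]big_seq_cond; apply: eq_bigr => -[|w x] /andP[].
    by rewrite mem_words.
  by rewrite mem_words => /eqP[xq] _; rewrite anc_cons// xq /q; lia.
rewrite (sum_label_step q y (fun x => g (anc k x))).
have kq : (depth k <= depth q)%N by apply: leq_depth; rewrite /q; lia.
move: ys; rewrite addSn -/q depthS; case: ifP => qA; last first.
  by rewrite add0n => ys; rewrite -(IH q y erefl ys) exprS; field; rewrite n0.
case: y => // w y [ys]; rewrite anc_cons ?ys// -(IH q y erefl ys) !exprS; field.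
by rewrite n0.
Qed.

(** The label map is measure preserving. *)
Lemma sum_label p (g : word -> R) :
  \sum_(x <- words p) g (label x) =
  2 ^+ p / 2 ^+ depth p * \sum_(y <- words (depth p)) g y.
Proof.
have n0 j : 2 ^+ j != 0 :> R by rewrite expf_neq0// pnatr_eq0.
transitivity (\sum_(x <- words p) \sum_(y <- words (depth p)) if y == label x then g y else 0).
  apply: eq_big_seq => x /size_mem_words xp.
  by rewrite sum_words_pick// size_label xp.
rewrite exchange_big mulr_sumr; apply: eq_big_seq => y /size_mem_words yc.
rewrite -big_mkcond/=; have := sum_label_anc (fun=> g y) (leq0n p) yc.
rewrite depth0 expr0 divr1 mul1r [RHS]big_mkcond sum_words0 /= eq_sym.
rewrite /anc subn0 drop_size eqxx => H.
under eq_bigl do rewrite eq_sym.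
by rewrite -[X in _ = _ * X]H; field; rewrite !n0.
Qed.

End Fold.

(** * Random signs *)

(** The position of an interval in the breadth-first enumeration of the binary
    tree. It linearly orders the intervals so that larger levels come later; a
    block is determined by the signs that precede its members in this order. *)
Definition heap_code (u : word) : nat := foldr (fun (w : bool) m => (w + m.*2)%N) 1%N u.

Lemma heap_code_bounds u : (2 ^ size u <= heap_code u < 2 ^ (size u).+1)%N.
Proof.
elim: u => //= w u; rewrite [(2 ^ (size u).+2)%N]expnS [(2 ^ (size u).+1)%N]expnS.
by case: w; lia.
Qed.

Lemma heap_code_inj : injective heap_code.
Proof.
have c0 u : (0 < heap_code u)%N.
  by have /andP[+ _] := heap_code_bounds u; apply: leq_trans; rewrite expn_gt0.
elim=> [|w u IH] [|w' u'] //=.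
- by have := c0 u'; case: w'; lia.
- by have := c0 u; case: w; lia.
- move=> H; have [ww uu] : w = w' /\ heap_code u = heap_code u'.
    by move: H; case: w; case: w'; lia.
  by rewrite ww (IH _ uu).
Qed.

Lemma heap_code_size u v : (heap_code u <= heap_code v)%N -> (size u <= size v)%N.
Proof.
move=> uv; have /andP[h1 _] := heap_code_bounds u; have /andP[_ h2] := heap_code_bounds v.
have : (2 ^ size u < 2 ^ (size v).+1)%N by lia.
by rewrite ltn_exp2l.
Qed.

Section Random.
Variable N : nat.

(** Signs for all intervals of level at most [N], indexed by heap codes. The finite
    type of all choices, with the counting measure, is the probability space. *)
Definition signs := {ffun 'I_(2 ^ N.+1).+1 -> bool}.

Definition sbit (om : signs) (u : word) : bool := om (inord (heap_code u)).

Definition flip_sign (v : word) (om : signs) : signs :=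
  [ffun i => om i (+) (i == inord (heap_code v))].

Lemma flip_signK v : involutive (flip_sign v).
Proof. by move=> om; apply/ffunP => i; rewrite !ffunE addbK. Qed.

Lemma heap_code_lt u : (size u <= N)%N -> (heap_code u < (2 ^ N.+1).+1)%N.
Proof.
move=> uN; have /andP[_ h] := heap_code_bounds u.
have : (2 ^ (size u).+1 <= 2 ^ N.+1)%N by rewrite leq_exp2l.
lia.
Qed.

Lemma sbit_flip u v om : (size u <= N)%N -> (size v <= N)%N ->
  sbit (flip_sign v om) u = sbit om u (+) (u == v).
Proof.
move=> uN vN; rewrite /sbit ffunE; congr (_ (+) _).
rewrite -val_eqE /= !inordK ?heap_code_lt//.
by apply/eqP/eqP => [/heap_code_inj|->].
Qed.

(** A label depends on the signs of the strict ancestors only. *)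
Lemma label_flip A u v om : (size u <= N)%N -> (size v <= N)%N ->
  (size u <= size v)%N -> label A (sbit (flip_sign v om)) u = label A (sbit om) u.
Proof.
move=> uN vN; elim: u uN => //= w u IH uN uv.
rewrite IH; [|lia|lia]; rewrite sbit_flip//; last by lia.
have -> : u == v = false by apply/eqP => E; move: uv; rewrite E ltnn.
by rewrite addbF.
Qed.

Variable R : realFieldType.

Definition hsign (om : signs) (u : word) : R := (-1) ^+ sbit om u.

Lemma hsign_sq om u : hsign om u * hsign om u = 1.
Proof. by rewrite /hsign; case: (sbit om u); rewrite ?mulrNN mulr1. Qed.

Lemma normr_hsign om u : `|hsign om u| = 1.
Proof. by rewrite normrX normrN1 expr1n. Qed.

Lemma hsign_flip u v om : (size u <= N)%N -> (size v <= N)%N ->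
  hsign (flip_sign v om) u = (-1) ^+ (u == v) * hsign om u.
Proof. by move=> uN vN; rewrite /hsign sbit_flip// signr_addb mulrC. Qed.

Lemma sum_odd v (f : signs -> R) :
  (forall om, f (flip_sign v om) = - f om) -> \sum_om f om = 0.
Proof.
move=> fN; have : \sum_om f om = - \sum_om f om; last by lra.
rewrite -sumrN [LHS](reindex_inj (inv_inj (flip_signK v))).
by apply: eq_bigr => om _; rewrite fN.
Qed.

(** Orthogonality: if [c K] depends only on the signs that precede [K], then the
    terms of the sum are martingale differences. In a product of two distinct
    terms, flipping the sign of the later interval changes the sign of the product. *)
Lemma sum_sq_sign (S : seq word) (c : word -> signs -> R) : uniq S ->
  {in S, forall K, (size K <= N)%N} ->
  {in S &, forall K K', (heap_code K <= heap_code K')%N ->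
    forall om, c K (flip_sign K' om) = c K om} ->
  \sum_om (\sum_(K <- S) hsign om K * c K om) ^+ 2 = \sum_om \sum_(K <- S) c K om ^+ 2.
Proof.
move=> uS SN cS.
under eq_bigr => om _ do rewrite expr2 mulr_suml.
rewrite exchange_big [RHS]exchange_big/=; apply: eq_big_seq => K KS.
under eq_bigr => om _ do rewrite mulr_sumr (bigD1_seq K)//=.
rewrite big_split/= [X in _ + X](_ : _ = 0) ?addr0.
  by apply: eq_bigr => om _; rewrite mulrACA hsign_sq mul1r.
rewrite exchange_big/= big_seq_cond big1// => K' /andP[K'S K'K].
have [le|lt] := leqP (heap_code K) (heap_code K').
  apply: (@sum_odd K') => om; rewrite !hsign_flip ?SN// (cS K K')// (cS K' K')//.
  by rewrite eqxx eq_sym (negbTE K'K); ring.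
apply: (@sum_odd K) => om; rewrite !hsign_flip ?SN// (cS K' K) ?(ltnW lt)// (cS K K)//.
by rewrite eqxx (negbTE K'K); ring.
Qed.

Definition mean (f : signs -> R) : R := (\sum_om f om) / #|{: signs}|%:R.

Lemma card_signs_gt0 : 0 < #|{: signs}|%:R :> R.
Proof. by rewrite ltr0n card_ffun card_bool card_ord expn_gt0. Qed.

Lemma mean_le f g : (forall om, f om <= g om) -> mean f <= mean g.
Proof.
by move=> fg; rewrite ler_pM2r ?invr_gt0 ?card_signs_gt0//; exact: ler_sum.
Qed.

Lemma mean_cst c : mean (fun=> c) = c.
Proof.
rewrite /mean sumr_const -[c *+ _]mulr_natr -mulrA divff ?mulr1//.
exact: lt0r_neq0 card_signs_gt0.
Qed.

Lemma meanD f g : mean (fun om => f om + g om) = mean f + mean g.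
Proof. by rewrite /mean big_split mulrDl. Qed.

Lemma meanZ c f : mean (fun om => c * f om) = c * mean f.
Proof. by rewrite /mean -mulr_sumr mulrA. Qed.

Lemma mean_sum (T : Type) (s : seq T) (F : T -> signs -> R) :
  mean (fun om => \sum_(i <- s) F i om) = \sum_(i <- s) mean (F i).
Proof. by rewrite /mean exchange_big mulr_suml. Qed.

Lemma eq_mean f g : f =1 g -> mean f = mean g.
Proof. by move=> fg; rewrite /mean (eq_bigr g). Qed.

Lemma mean_le_cst f c : (forall om, f om <= c) -> mean f <= c.
Proof. by move=> fc; rewrite -[leRHS]mean_cst; exact: mean_le. Qed.

Lemma mean_sq_sign (S : seq word) (c : word -> signs -> R) : uniq S ->
  {in S, forall K, (size K <= N)%N} ->
  {in S &, forall K K', (heap_code K <= heap_code K')%N ->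
    forall om, c K (flip_sign K' om) = c K om} ->
  mean (fun om => (\sum_(K <- S) hsign om K * c K om) ^+ 2) =
  \sum_(K <- S) mean (fun om => c K om ^+ 2).
Proof. by move=> uS SN cS; rewrite /mean sum_sq_sign// exchange_big mulr_suml. Qed.

Lemma mean_exists f c : mean f < c -> exists om, f om < c.
Proof.
move=> fc; case: (pickP (fun om => f om < c)) => [om fo|H]; first by exists om.
have : c <= mean f.
  by rewrite -[leLHS]mean_cst; apply: mean_le => om; rewrite leNgt H.
by rewrite leNgt fc.
Qed.

End Random.

(** * Second moments of bilinear sums and of block averages *)

Section Moments.
Variables (N : nat) (A : seq nat) (R : realFieldType).
Implicit Types (om : signs N) (t : word -> word -> R).

(** The coefficient of h_K in b_I, if [K] has the level at which b_I lives. *)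
Definition blk om (I K : word) : R := hsign R om K * (label A (sbit om) K == I)%:R.

Lemma le1_natb (b : bool) : b%:R <= 1 :> R.
Proof. by case: b. Qed.

Lemma sqr_natb (b : bool) : b%:R ^+ 2 = b%:R :> R.
Proof. by case: b; rewrite ?expr1n ?expr0n. Qed.

(** Orthogonality is used twice. With the later interval [K'] outside, its
    coefficient, the sum over the earlier [K], is determined by preceding signs. Then
    the indicator of [label K' = I'] is bounded by 1, which leaves a linear sum
    in the signs of the [K] for each fixed [K']. *)
Lemma mean_sq_offdiag_half k k' I I' t : (k <= N)%N -> (k' <= N)%N ->
  mean (fun om => (\sum_(K' <- words k') \sum_(K <- words k)
     (heap_code K < heap_code K')%:R * (blk om I K * blk om I' K' * t K K')) ^+ 2) <=
  \sum_(K <- words k) \sum_(K' <- words k') t K K' ^+ 2.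
Proof.
move=> kN k'N.
pose d K' K om := (heap_code K < heap_code K')%:R * (label A (sbit om) K == I)%:R * t K K'.
pose c K' om := (label A (sbit om) K' == I')%:R * \sum_(K <- words k) hsign R om K * d K' K om.
have -> : mean (fun om => (\sum_(K' <- words k') \sum_(K <- words k)
     (heap_code K < heap_code K')%:R * (blk om I K * blk om I' K' * t K K')) ^+ 2) =
   mean (fun om => (\sum_(K' <- words k') hsign R om K' * c K' om) ^+ 2).
  apply: eq_mean => om; congr (_ ^+ 2); apply: eq_bigr => K' _.
  rewrite /c mulrA mulr_sumr; apply: eq_bigr => K _.
  by rewrite /blk /d; ring.
have dflip K' K K'' om : K \in words k -> K' \in words k' -> K'' \in words k' ->
    (heap_code K' <= heap_code K'')%N ->
    hsign R (flip_sign K'' om) K * d K' K (flip_sign K'' om) = hsign R om K * d K' K om.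
  move=> /size_mem_words Kk /size_mem_words K'k /size_mem_words K''k cK.
  rewrite /d; have [lt|] := boolP (heap_code K < heap_code K')%N; last by rewrite !mul0r !mulr0.
  have KK'' : (heap_code K < heap_code K'')%N by lia.
  have szK := heap_code_size (ltnW KK'').
  rewrite hsign_flip ?label_flip ?Kk ?K''k//; last by rewrite -Kk -K''k.
  have -> : K == K'' = false by apply/eqP => E; rewrite E ltnn in KK''.
  by rewrite mul1r.
rewrite mean_sq_sign ?words_uniq//; first last.
- move=> K K' Kk K'k cK om; rewrite /c label_flip.
  + by congr (_ * _); apply: eq_big_seq => K'' K''k; exact: dflip.
  + by rewrite (size_mem_words Kk).
  + by rewrite (size_mem_words K'k).
  + exact: heap_code_size.
- by move=> K /size_mem_words ->.
rewrite [leRHS]exchange_big/=; apply: ler_sum_seq => K' K'k.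
apply: (@le_trans _ _ (mean (fun om => (\sum_(K <- words k) hsign R om K * d K' K om) ^+ 2))).
  (* here the indicator of [label K' = I'] is dropped *)
  apply: mean_le => om; rewrite /c exprMn sqr_natb.
  by case: (_ == _); rewrite ?mul1r// mul0r sqr_ge0.
rewrite mean_sq_sign ?words_uniq//; first last.
- move=> K K'' Kk K''k cK om; rewrite /d label_flip//.
  + by rewrite (size_mem_words Kk).
  + by rewrite (size_mem_words K''k).
  + exact: heap_code_size.
- by move=> K /size_mem_words ->.
apply: ler_sum => K _; apply: mean_le_cst => om; rewrite /d !exprMn !sqr_natb.
by case: (_ < _)%N; case: (_ == _); rewrite ?(mul0r, mul1r) ?sqr_ge0.
Qed.

Lemma sqrD_le (x y : R) : (x + y) ^+ 2 <= 2 * x ^+ 2 + 2 * y ^+ 2.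
Proof. by have := sqr_ge0 (x - y); rewrite !expr2; lra. Qed.

(** A sum over pairs of distinct intervals splits according to which of the two
    comes first. *)
Lemma mean_sq_offdiag k k' I I' t : (k <= N)%N -> (k' <= N)%N ->
  mean (fun om => (\sum_(K <- words k) \sum_(K' <- words k')
     (K != K')%:R * (blk om I K * blk om I' K' * t K K')) ^+ 2) <=
  4 * \sum_(K <- words k) \sum_(K' <- words k') t K K' ^+ 2.
Proof.
move=> kN k'N.
pose F1 om := \sum_(K' <- words k') \sum_(K <- words k)
     (heap_code K < heap_code K')%:R * (blk om I K * blk om I' K' * t K K').
pose F2 om := \sum_(K <- words k) \sum_(K' <- words k')
     (heap_code K' < heap_code K)%:R * (blk om I' K' * blk om I K * t K K').
apply: (@le_trans _ _ (mean (fun om => 2 * F1 om ^+ 2 + 2 * F2 om ^+ 2))).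
  apply: mean_le => om; apply: le_trans (sqrD_le (F1 om) (F2 om)).
  suff -> : F1 om + F2 om = \sum_(K <- words k) \sum_(K' <- words k')
     (K != K')%:R * (blk om I K * blk om I' K' * t K K') by [].
  rewrite /F1 /F2 exchange_big -big_split/=; apply: eq_bigr => K _.
  rewrite -big_split/=; apply: eq_bigr => K' _.
  rewrite [blk om I' K' * blk om I K]mulrC -mulrDl; congr (_ * _).
  have -> : (K != K') = (heap_code K != heap_code K') by rewrite (inj_eq heap_code_inj).
  by case: ltngtP; rewrite ?addr0 ?add0r.
rewrite meanD !meanZ.
set S := \sum_(K <- words k) _.
have H1 : mean (fun om => F1 om ^+ 2) <= S by exact: mean_sq_offdiag_half.
have H2 : mean (fun om => F2 om ^+ 2) <= S.
  rewrite /S exchange_big; exact: (mean_sq_offdiag_half I' I (fun K' K => t K K')).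
by lra.
Qed.

(** Let Y_j be the sum of [t] over the intervals of level [k] whose ancestor of
    level [j] has the label [y]. At a level [j] of [A] each interval of level [j]
    gives one of its halves to the new label, according to its sign. So Y_{j+1} is
    half of Y_j plus half of a linear sum in the signs of level [j], with
    coefficients at most [m * 2 ^- j]. Hence the second moment of the deviation of
    Y_j from its expectation remains below [m ^+ 2 * q] by convexity. *)
Lemma mean_sq_label_avg k j y (t : word -> R) (m q : R) :
  uniq A -> (j <= k)%N -> (k <= N)%N -> size y = depth A j ->
  0 <= m -> 0 <= q -> (forall a, a \in A -> 2 ^- a <= q) ->
  (forall K, size K = k -> `|t K| <= m * 2 ^- k) ->
  mean (fun om => (\sum_(K <- words k) (label A (sbit om) (anc j K) == y)%:R * t K
      - 2 ^- depth A j * \sum_(K <- words k) t K) ^+ 2) <= m ^+ 2 * q.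
Proof.
move=> uA jk kN ys m0 q0 Aq tm.
have n0 i : 2 ^+ i != 0 :> R by rewrite expf_neq0// pnatr_eq0.
have p0 i : 0 <= 2 ^- i :> R by rewrite invr_ge0 exprn_ge0.
elim: j jk y ys => [|j IH] jk y ys.
  rewrite depth0 in ys *; case: y ys => // _.
  apply: mean_le_cst => om; rewrite invr1 mul1r.
  rewrite (_ : _ - _ = 0) ?expr0n ?mulr_ge0 ?sqr_ge0//.
  apply/eqP; rewrite subr_eq0; apply/eqP; apply: eq_bigr => K _.
  by rewrite /anc subn0 drop_size eqxx mul1r.
have ancE K : size K = k -> exists w, anc j.+1 K = w :: anc j K.
  move=> Kk; have := @size_anc j.+1 K; rewrite Kk => /(_ jk).
  have : anc j (anc j.+1 K) = anc j K by rewrite anc_anc// Kk; lia.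
  case E : (anc j.+1 K) => [|w u]//= H [us]; exists w.
  by rewrite -H anc_cons ?us// anc_size.
move: ys; rewrite depthS//; case jA : (j \in A); last first.
  move=> ys; apply: le_trans (IH (ltnW jk) y ys); apply: mean_le => om.
  rewrite add0n le_eqVlt; apply/orP; left; apply/eqP; congr ((_ - _) ^+ 2).
  apply: eq_big_seq => K /size_mem_words Kk; have [w ->] := ancE _ Kk.
  by rewrite /= size_anc ?jA// Kk ltnW.
case: y => // w' y [ys]; rewrite add1n exprS.
(* the half of [anc j K] in which [K] lies *)
pose hd (K : word) := head false (anc j.+1 K).
pose c (Kh : word) : R :=
  \sum_(K <- words k) (anc j K == Kh)%:R * ((-1) ^+ (hd K (+) w') * t K).
pose V om := \sum_(Kh <- words j) hsign R om Kh * ((label A (sbit om) Kh == y)%:R * c Kh).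
pose U om := \sum_(K <- words k) (label A (sbit om) (anc j K) == y)%:R * t K
      - 2 ^- depth A j * \sum_(K <- words k) t K.
have E om : \sum_(K <- words k) (label A (sbit om) (anc j.+1 K) == w' :: y)%:R * t K
      - (2 * 2 ^+ depth A j)^-1 * \sum_(K <- words k) t K = (U om + V om) / 2.
  have -> : V om = \sum_(K <- words k) hsign R om (anc j K) *
       ((label A (sbit om) (anc j K) == y)%:R * ((-1) ^+ (hd K (+) w') * t K)).
    rewrite /V /c; under eq_bigr do rewrite mulrA mulr_sumr.
    rewrite exchange_big/=; apply: eq_big_seq => K /size_mem_words Kk.
    rewrite -[RHS](@sum_words_pick _ j (fun Kh => hsign R om Kh *
       ((label A (sbit om) Kh == y)%:R * ((-1) ^+ (hd K (+) w') * t K)))); last first.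
      by rewrite size_anc// Kk ltnW.
    apply: eq_bigr => Kh _; rewrite (eq_sym Kh); case: (anc j K == Kh).
      by rewrite mul1r !mulrA.
    by rewrite mul0r mulr0.
  rewrite /U addrAC -big_split/= mulrBl mulr_suml; congr (_ - _); last first.
    by field; rewrite n0.
  apply: eq_big_seq => K /size_mem_words Kk; rewrite /hd.
  have [w ->] := ancE _ Kk; rewrite /= size_anc ?jA ?Kk ?(ltnW jk)//.
  rewrite eqseq_cons /hsign; case: (label _ _ _ == y); last by rewrite andbF !mul0r mulr0 addr0 mul0r.
  case: (sbit om (anc j K)); case: w; case: (w'); rewrite /= ?expr1 ?expr0; by field.
have cb Kh : Kh \in words j -> `|c Kh| <= m * 2 ^- j.
  move=> Khj; apply: le_trans (ler_norm_sum _ _ _) _.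
  apply: (@le_trans _ _ (\sum_(K <- words k) (anc j K == Kh)%:R * (m * 2 ^- k))).
    apply: ler_sum_seq => K /size_mem_words Kk.
    rewrite !normrM normrX normrN1 expr1n mul1r normr_nat ler_wpM2l//.
    exact: tm.
  rewrite (sum_anc (fun u => (u == Kh)%:R * (m * 2 ^- k))) ?(ltnW jk)//.
  have -> : \sum_(u <- words j) (u == Kh)%:R * (m * 2 ^- k) = m * 2 ^- k.
    rewrite -[RHS](@sum_words_pick _ j (fun=> m * 2 ^- k) Kh); last exact: size_mem_words.
    by apply: eq_bigr => u _; case: eqP => _; rewrite ?mul1r ?mul0r.
  rewrite mulrCA ler_wpM2l//.
  by rewrite exprB ?unitfE ?pnatr_eq0// ?(ltnW jk)// mulrAC divff// mul1r.
apply: (@le_trans _ _ (mean (fun om => 2^-1 * (U om ^+ 2) + 2^-1 * (V om ^+ 2)))).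
  apply: mean_le => om; rewrite E exprMn.
  by have := sqrD_le (U om) (V om); rewrite !expr2; lra.
rewrite meanD !meanZ.
have HU := IH (ltnW jk) y ys.
suff HV : mean (fun om => V om ^+ 2) <= m ^+ 2 * q by rewrite /U; lra.
rewrite /V mean_sq_sign ?words_uniq//; first last.
- move=> K K' Kj K'j cK om; rewrite label_flip//.
  + by rewrite (size_mem_words Kj); lia.
  + by rewrite (size_mem_words K'j); lia.
  + exact: heap_code_size.
- by move=> K /size_mem_words ->; lia.
apply: (@le_trans _ _ (\sum_(K <- words j) (m * 2 ^- j) ^+ 2)).
  apply: ler_sum_seq => K Kj; apply: mean_le_cst => om.
  rewrite exprMn sqr_natb.
  have : c K ^+ 2 <= (m * 2 ^- j) ^+ 2.
    by rewrite -real_normK ?num_real// lerXn2r ?nnegrE ?mulr_ge0//; exact: cb.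
  by apply: le_trans; rewrite ler_piMl ?sqr_ge0 ?le1_natb.
rewrite big_const_seq count_predT size_words iter_addr_0 -[_ *+ _]mulr_natr natrX exprMn.
rewrite -mulrA ler_wpM2l ?sqr_ge0//.
have -> : (2 ^- j) ^+ 2 * 2 ^+ j = 2 ^- j :> R by rewrite expr2; field; rewrite n0.
exact: Aq.
Qed.

End Moments.

(** * Choice of the signs *)

Section Helpers.
Variable R : realFieldType.

Lemma le_sum_term (T : eqType) (s : seq T) (F : T -> R) x :
  x \in s -> (forall i, 0 <= F i) -> F x <= \sum_(i <- s) F i.
Proof.
move=> xs F0; rewrite (big_rem x)//= lerDl; exact: sumr_ge0.
Qed.

Lemma sum_sqr_le (T : Type) (s : seq T) (F : T -> R) :
  \sum_(i <- s) F i ^+ 2 <= (\sum_(i <- s) `|F i|) ^+ 2.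
Proof.
elim: s => [|i s IH]; first by rewrite !big_nil expr0n.
have S0 : 0 <= \sum_(i <- s) `|F i| by apply: sumr_ge0.
rewrite !big_cons sqrrD real_normK ?num_real// -addrA lerD2l.
by apply: le_trans IH _; rewrite lerDr mulrn_wge0// mulr_ge0.
Qed.

Lemma sum_words_cst k (c : R) : \sum_(K <- words k) c = 2 ^+ k * c.
Proof.
by rewrite big_const_seq count_predT size_words iter_addr_0 -[_ *+ _]mulr_natr natrX mulrC.
Qed.

(** Square sums are bounded by the row sums; the factor 2^-k comes from the 2^k rows
    of size 2^-k each. *)
Lemma row_sqr k (T : Type) (s : seq T) (t : word -> T -> R) (M : R) : 0 <= M ->
  (forall K, size K = k -> \sum_(K' <- s) `|t K K'| <= M * 2 ^- k) ->
  \sum_(K <- words k) \sum_(K' <- s) t K K' ^+ 2 <= M ^+ 2 * 2 ^- k.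
Proof.
move=> M0 H.
apply: (@le_trans _ _ (\sum_(K <- words k) (M * 2 ^- k) ^+ 2)).
  apply: ler_sum_seq => K /size_mem_words Kk; apply: le_trans (sum_sqr_le _ _) _.
  rewrite lerXn2r ?nnegrE ?H//; first by apply: sumr_ge0.
  by rewrite mulr_ge0// invr_ge0 exprn_ge0.
rewrite sum_words_cst le_eqVlt; apply/orP; left; apply/eqP.
have : 2 ^+ k != 0 :> R by rewrite expf_neq0// pnatr_eq0.
by rewrite !expr2 => ?; field.
Qed.

End Helpers.

(** The level of the intervals that make up the blocks b_I with [size I = i]. *)
Definition level (ks : seq nat) (i : nat) : nat := nth 0%N ks i.

Lemma depth_level ks i : sorted ltn ks -> (i < size ks)%N -> depth ks (level ks i) = i.
Proof.
move=> ss iks; rewrite /depth -[X in count _ X](cat_take_drop i) count_cat.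
have nth_lt := sorted_ltn_nth ltn_trans 0%N ss.
have -> : count (fun a => (a < level ks i)%N) (take i ks) = i.
  rewrite -[RHS](size_takel (ltnW iks)); apply/eqP; rewrite -all_count.
  apply/(all_nthP 0%N) => j; rewrite size_take iks => ji.
  rewrite nth_take//; apply: nth_lt => //; rewrite inE; lia.
have -> : count (fun a => (a < level ks i)%N) (drop i ks) = 0%N; last by rewrite addn0.
apply/eqP; rewrite -leqn0 leqNgt -has_count; apply/negP => /(has_nthP 0%N)[j].
rewrite size_drop nth_drop /level => ji.
have [->|j0] := posnP j; first by rewrite addn0 ltnn.
have : (nth 0 ks i < nth 0 ks (i + j))%N by apply: nth_lt; rewrite ?inE; lia.
lia.
Qed.

Section Core.
Variables (R : realFieldType) (N n : nat) (M q : R).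

(** The levels [ks] carry n + 1 generations of blocks, and all of them are so fine
    that the second moments, which are proportional to 2^-k, stay below [q]. *)
Definition admissible (ks : seq nat) := [/\ sorted ltn ks, size ks = n.+1,
  {in ks, forall k, (k <= N)%N} & {in ks, forall k, 2 ^- k <= q}].

Lemma admissible_uniq ks : admissible ks -> uniq ks.
Proof. by case=> ss _ _ _; apply: sorted_uniq ss; [exact: ltn_trans|exact: ltnn]. Qed.

Lemma level_mem ks i : admissible ks -> (i <= n)%N -> level ks i \in ks.
Proof. by case=> _ sz _ _ iN; apply: mem_nth; rewrite sz. Qed.

Lemma level_le ks i : admissible ks -> (i <= n)%N -> (level ks i <= N)%N.
Proof. by move=> gk iN; case: (gk) => _ _ H _; apply: H; exact: level_mem. Qed.

Lemma level_small ks i : admissible ks -> (i <= n)%N -> 2 ^- level ks i <= q.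
Proof. by move=> gk iN; case: (gk) => _ _ _ H; apply: H; exact: level_mem. Qed.

Lemma depth_admissible ks i : admissible ks -> (i <= n)%N -> depth ks (level ks i) = i.
Proof. by case=> ss sz _ _ iN; apply: depth_level; rewrite ?sz. Qed.

Lemma normr_blk ks (om : signs N) I K : `|blk ks R om I K| <= 1.
Proof. by rewrite normrM normr_hsign mul1r normr_nat le1_natb. Qed.

(** An interval belongs to one block of its level at most, so the terms with
    [K = K'] contribute only if [I = I'], and then the signs cancel. *)
Lemma diag_split ks (om : signs N) I I' (G : word -> word -> R) :
  \sum_(K <- words (level ks (size I))) \sum_(K' <- words (level ks (size I')))
     blk ks R om I K * blk ks R om I' K' * G K K' =
  \sum_(K <- words (level ks (size I))) \sum_(K' <- words (level ks (size I')))
     (K != K')%:R * (blk ks R om I K * blk ks R om I' K' * G K K') +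
  (I == I')%:R * \sum_(K <- words (level ks (size I))) (label ks (sbit om) K == I)%:R * G K K.
Proof.
rewrite mulr_sumr -big_split/=; apply: eq_big_seq => K /size_mem_words Kk.
transitivity (\sum_(K' <- words (level ks (size I')))
     ((K != K')%:R * (blk ks R om I K * blk ks R om I' K' * G K K') +
      (if K' == K then blk ks R om I K * blk ks R om I' K' * G K K' else 0))).
  apply: eq_bigr => K' _; rewrite (eq_sym K'); case: (K == K').
    by rewrite mul0r add0r.
  by rewrite mul1r addr0.
rewrite big_split/=; congr (_ + _).
have [<-|II'] := eqVneq I I'.
  rewrite sum_words_pick// mul1r; congr (_ * _).
  by rewrite /blk mulrACA hsign_sq mul1r -expr2 sqr_natb.
rewrite mul0r big1// => K' _; case: eqP => // ->; rewrite /blk mulrACA.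
case: (label _ _ K =P I) => [->|_]; last by rewrite mul0r mulr0 mul0r.
by rewrite (negbTE II') !mulr0 mul0r.
Qed.

Variable t : word -> word -> word -> word -> R.
Hypotheses (M0 : 0 <= M) (q0 : 0 <= q).
Hypothesis trow : forall K L k' l', (size K <= N)%N -> (size L <= N)%N ->
  (k' <= N)%N -> (l' <= N)%N ->
  \sum_(K' <- words k') \sum_(L' <- words l') `|t K L K' L'|
    <= M * (2 ^- size K * 2 ^- size L).

Lemma diag_entry_le K L : (size K <= N)%N -> (size L <= N)%N ->
  `|t K L K L| <= M * (2 ^- size K * 2 ^- size L).
Proof.
move=> KN LN; apply: le_trans (trow KN LN KN LN).
have H0 : forall K', 0 <= \sum_(L' <- words (size L)) `|t K L K' L'| by move=> K'; apply: sumr_ge0.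
apply: le_trans (le_sum_term (x := K) _ H0); last by rewrite mem_words.
apply: (@le_sum_term _ _ (words (size L)) (fun L' => `|t K L K L'|) L) => //.
by rewrite mem_words.
Qed.

Variables ks ls : seq nat.
Hypotheses (gk : admissible ks) (gl : admissible ls).

(** If [t] is the matrix of an operator, this is the average of its diagonal
    multipliers over the rectangles of levels [k] and [l]. *)
Definition diagsum k l : R := \sum_(K <- words k) \sum_(L <- words l) t K L K L.

(** For the matrix [t] of T this is the scalar product of T b_{IxJ} with b_{I'xJ'}. *)
Definition pairing (om om' : signs N) I J I' J' : R :=
  \sum_(K <- words (level ks (size I))) \sum_(K' <- words (level ks (size I')))
    blk ks R om I K * blk ks R om I' K' *
  \sum_(L <- words (level ls (size J))) \sum_(L' <- words (level ls (size J')))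
    blk ls R om' J L * blk ls R om' J' L' * t K L K' L'.

Definition pairing_err om om' I J I' J' : R := pairing om om' I J I' J' -
  (I == I')%:R * ((J == J')%:R *
    (2 ^- size I * (2 ^- size J * diagsum (level ks (size I)) (level ls (size J))))).

Lemma half_pow_ge0 i : 0 <= 2 ^- i :> R.
Proof. by rewrite invr_ge0 exprn_ge0. Qed.

Lemma half_powK i : 2 ^+ i * 2 ^- i = 1 :> R.
Proof. by rewrite divff// expf_neq0// pnatr_eq0. Qed.

(** Splitting off the diagonal first in the intervals [K] and then in the
    intervals [L] leaves two off-diagonal sums E1 and E2. What remains is the sum of
    the diagonal entries over the rectangles in the block of IxJ; E3 and E4 compare
    it, one variable after the other, with the part 2^-i 2^-j of the full diagonal
    sum. *)
Lemma mean_pairing_err I J I' J' : (size I <= n)%N -> (size J <= n)%N ->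
  (size I' <= n)%N -> (size J' <= n)%N ->
  mean (fun om' : signs N => mean (fun om : signs N => pairing_err om om' I J I' J' ^+ 2)) <=
  40 * (M ^+ 2 * q).
Proof.
move=> In Jn I'n J'n.
set k := level ks (size I); set k' := level ks (size I').
set l := level ls (size J); set l' := level ls (size J').
have kN : (k <= N)%N by exact: level_le.
have k'N : (k' <= N)%N by exact: level_le.
have lN : (l <= N)%N by exact: level_le.
have l'N : (l' <= N)%N by exact: level_le.
have uk := admissible_uniq gk; have ul := admissible_uniq gl.
pose tau (om' : signs N) K K' := \sum_(L <- words l) \sum_(L' <- words l')
    blk ls R om' J L * blk ls R om' J' L' * t K L K' L'.
pose sig (om : signs N) L L' := \sum_(K <- words k) (label ks (sbit om) K == I)%:R * t K L K L'.
pose ta (om' : signs N) K := \sum_(L <- words l) (label ls (sbit om') L == J)%:R * t K L K L.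
pose si L := \sum_(K <- words k) t K L K L.
pose E1 (om om' : signs N) := \sum_(K <- words k) \sum_(K' <- words k')
     (K != K')%:R * (blk ks R om I K * blk ks R om I' K' * tau om' K K').
pose E2 (om om' : signs N) := (I == I')%:R * \sum_(L <- words l) \sum_(L' <- words l')
     (L != L')%:R * (blk ls R om' J L * blk ls R om' J' L' * sig om L L').
pose E3 (om om' : signs N) := (I == I')%:R * ((J == J')%:R *
  (\sum_(K <- words k) (label ks (sbit om) (anc k K) == I)%:R * ta om' K
      - 2 ^- depth ks k * \sum_(K <- words k) ta om' K)).
pose E4 (om' : signs N) := (I == I')%:R * ((J == J')%:R * (2 ^- size I *
  (\sum_(L <- words l) (label ls (sbit om') (anc l L) == J)%:R * si L
      - 2 ^- depth ls l * \sum_(L <- words l) si L))).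
have errE om om' : pairing_err om om' I J I' J' = E1 om om' + E2 om om' + E3 om om' + E4 om'.
  rewrite /pairing_err /pairing diag_split -/k -/k' -/l -/l' -/(tau om') -!addrA; congr (_ + _).
  rewrite /E2 /E3 /E4 -mulrBr -!mulrDr; congr (_ * _).
  have -> : \sum_(K <- words k) (label ks (sbit om) K == I)%:R *
     (\sum_(L <- words l) \sum_(L' <- words l')
        blk ls R om' J L * blk ls R om' J' L' * t K L K L') =
     \sum_(L <- words l) \sum_(L' <- words l')
        blk ls R om' J L * blk ls R om' J' L' * sig om L L'.
    under eq_bigr do rewrite mulr_sumr.
    rewrite exchange_big/=; apply: eq_bigr => L _.
    under eq_bigr do rewrite mulr_sumr.
    rewrite exchange_big/=; apply: eq_bigr => L' _.
    by rewrite mulr_sumr; apply: eq_bigr => K _; ring.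
  rewrite diag_split -/l -/l' -addrA; congr (_ + _).
  rewrite -mulrBr; congr (_ * _).
  have -> : \sum_(K <- words k) (label ks (sbit om) (anc k K) == I)%:R * ta om' K =
     \sum_(L <- words l) (label ls (sbit om') L == J)%:R * sig om L L.
    under eq_bigr do rewrite mulr_sumr.
    rewrite exchange_big/=; apply: eq_bigr => L _.
    rewrite mulr_sumr; apply: eq_big_seq => K /size_mem_words Kk.
    by rewrite (anc_size Kk); ring.
  have -> : \sum_(K <- words k) ta om' K =
      \sum_(L <- words l) (label ls (sbit om') (anc l L) == J)%:R * si L.
    rewrite /ta exchange_big/=; apply: eq_big_seq => L /size_mem_words Ll.
    by rewrite (anc_size Ll) mulr_sumr.
  have -> : \sum_(L <- words l) si L = diagsum k l by rewrite /diagsum exchange_big.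
  rewrite !depth_admissible//; ring.
have le1sq (b : bool) (x : R) : (b%:R * x) ^+ 2 <= x ^+ 2.
  by rewrite exprMn sqr_natb ler_piMl ?sqr_ge0 ?le1_natb.
have bbN (om' : signs N) L L' x : `|blk ls R om' J L * blk ls R om' J' L' * x| <= `|x| :> R.
  have b1 := normr_blk ls om' J L; have b2 := normr_blk ls om' J' L'.
  move: b1 b2; move: (blk _ _ _ J _) (blk _ _ _ J' _) => b b' b1 b2.
  by rewrite normrM ler_piMl// normrM mulr_ile1.
have H1 om' : mean (fun om => E1 om om' ^+ 2) <= 4 * (M ^+ 2 * q).
  apply: le_trans (mean_sq_offdiag ks I I' (tau om') kN k'N) _.
  rewrite ler_pM2l//; apply: (@le_trans _ _ (M ^+ 2 * 2 ^- k)); last first.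
    by rewrite ler_wpM2l ?sqr_ge0 ?level_small.
  apply: row_sqr => // K Kk.
  apply: (@le_trans _ _ (\sum_(L <- words l) \sum_(K' <- words k') \sum_(L' <- words l')
     `|t K L K' L'|)).
    rewrite [leRHS]exchange_big/=; apply: ler_sum => K' _.
    apply: le_trans (ler_norm_sum _ _ _) _; apply: ler_sum => L _.
    by apply: le_trans (ler_norm_sum _ _ _) _; apply: ler_sum => L' _.
  apply: (@le_trans _ _ (\sum_(L <- words l) M * (2 ^- k * 2 ^- l))).
    by apply: ler_sum_seq => L /size_mem_words Ll; rewrite -Kk -Ll trow// ?Kk ?Ll.
  by rewrite sum_words_cst [2 ^- k * _]mulrC !mulrA [_ * M]mulrC -(mulrA M) half_powK mulr1.
have H2 om : mean (fun om' => E2 om om' ^+ 2) <= 4 * (M ^+ 2 * q).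
  apply: (@le_trans _ _ (mean (fun om' => (\sum_(L <- words l) \sum_(L' <- words l')
     (L != L')%:R * (blk ls R om' J L * blk ls R om' J' L' * sig om L L')) ^+ 2))).
    by apply: mean_le => om'; exact: le1sq.
  apply: le_trans (mean_sq_offdiag ls J J' (sig om) lN l'N) _.
  rewrite ler_pM2l//; apply: (@le_trans _ _ (M ^+ 2 * 2 ^- l)); last first.
    by rewrite ler_wpM2l ?sqr_ge0 ?level_small.
  apply: row_sqr => // L Ll.
  apply: (@le_trans _ _ (\sum_(K <- words k) \sum_(L' <- words l') `|t K L K L'|)).
    rewrite [leRHS]exchange_big/=; apply: ler_sum => L' _.
    apply: le_trans (ler_norm_sum _ _ _) _; apply: ler_sum => K _.
    by rewrite normrM normr_nat ler_piMl// le1_natb.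
  apply: (@le_trans _ _ (\sum_(K <- words k) M * (2 ^- k * 2 ^- l))).
    apply: ler_sum_seq => K /size_mem_words Kk.
    have := @trow K L k l'; rewrite Kk Ll => /(_ kN lN kN l'N); apply: le_trans.
    apply: (@le_sum_term _ _ (words k) (fun K' => \sum_(L' <- words l') `|t K L K' L'|) K).
      by rewrite mem_words Kk.
    by move=> K'; apply: sumr_ge0.
  by rewrite sum_words_cst !mulrA [_ * M]mulrC -(mulrA M) half_powK mulr1.
have H3 om' : mean (fun om => E3 om om' ^+ 2) <= M ^+ 2 * q.
  apply: (@le_trans _ _ (mean (fun om =>
     (\sum_(K <- words k) (label ks (sbit om) (anc k K) == I)%:R * ta om' K
      - 2 ^- depth ks k * \sum_(K <- words k) ta om' K) ^+ 2))).
    by apply: mean_le => om; apply: le_trans (le1sq _ _) _; exact: le1sq.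
  apply: mean_sq_label_avg => //; first by rewrite depth_admissible.
    by case: gk.
  move=> K Kk; apply: le_trans (ler_norm_sum _ _ _) _.
  apply: (@le_trans _ _ (\sum_(L <- words l) M * (2 ^- k * 2 ^- l))).
    apply: ler_sum_seq => L /size_mem_words Ll; rewrite normrM normr_nat.
    apply: (@le_trans _ _ `|t K L K L|); first by rewrite ler_piMl// le1_natb.
    by rewrite -Kk -Ll diag_entry_le// ?Kk ?Ll.
  by rewrite sum_words_cst [2 ^- k * _]mulrC !mulrA [_ * M]mulrC -(mulrA M) half_powK mulr1.
have H4 : mean (fun om' => E4 om' ^+ 2) <= M ^+ 2 * q.
  apply: (@le_trans _ _ (mean (fun om' =>
     (\sum_(L <- words l) (label ls (sbit om') (anc l L) == J)%:R * si L
      - 2 ^- depth ls l * \sum_(L <- words l) si L) ^+ 2))).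
    apply: mean_le => om; apply: le_trans (le1sq _ _) _; apply: le_trans (le1sq _ _) _.
    rewrite exprMn ler_piMl ?sqr_ge0// exprn_ile1 ?half_pow_ge0//.
    by rewrite invf_le1 ?exprn_gt0// exprn_ege1// ler1n.
  apply: mean_sq_label_avg => //; first by rewrite depth_admissible.
    by case: gl.
  move=> L Ll; apply: le_trans (ler_norm_sum _ _ _) _.
  apply: (@le_trans _ _ (\sum_(K <- words k) M * (2 ^- k * 2 ^- l))).
    by apply: ler_sum_seq => K /size_mem_words Kk; rewrite -Kk -Ll diag_entry_le// ?Kk ?Ll.
  by rewrite sum_words_cst !mulrA [_ * M]mulrC -(mulrA M) half_powK mulr1.
have sq4 (a b c d : R) : (a + b + c + d) ^+ 2 <=
    4 * a ^+ 2 + 4 * b ^+ 2 + (4 * c ^+ 2 + 4 * d ^+ 2).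
  have := sqrD_le (a + b) (c + d); have := sqrD_le a b; have := sqrD_le c d.
  by rewrite addrA; lra.
apply: (@le_trans _ _ (mean (fun om' => mean (fun om =>
   4 * E1 om om' ^+ 2 + 4 * E2 om om' ^+ 2 + (4 * E3 om om' ^+ 2 + 4 * E4 om' ^+ 2))))).
  by apply: mean_le => om'; apply: mean_le => om; rewrite errE; exact: sq4.
have H2' : mean (fun om' => mean (fun om => E2 om om' ^+ 2)) <= 4 * (M ^+ 2 * q).
  have -> : mean (fun om' => mean (fun om => E2 om om' ^+ 2)) =
            mean (fun om => mean (fun om' => E2 om om' ^+ 2)).
    by rewrite /mean -!mulr_suml exchange_big.
  exact: mean_le_cst.
have E om' : mean (fun om =>
   4 * E1 om om' ^+ 2 + 4 * E2 om om' ^+ 2 + (4 * E3 om om' ^+ 2 + 4 * E4 om' ^+ 2)) =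
   4 * mean (fun om => E1 om om' ^+ 2) + 4 * mean (fun om => E2 om om' ^+ 2) +
   (4 * mean (fun om => E3 om om' ^+ 2) + 4 * E4 om' ^+ 2).
  by rewrite !meanD !meanZ mean_cst.
rewrite (eq_mean E) !meanD !meanZ.
have H1' := mean_le_cst H1; have H3' := mean_le_cst H3.
by lra.
Qed.

(** First moment method: the mean of the sum of all squared errors is small, so
    this sum is small for some choice of signs. *)
Lemma exists_good_signs eps : 0 < eps ->
  (size (wordsle n))%:R ^+ 4 * (40 * (M ^+ 2 * q)) < eps ^+ 2 ->
  exists om om', forall I J I' J', (size I <= n)%N -> (size J <= n)%N ->
  (size I' <= n)%N -> (size J' <= n)%N -> `|pairing_err om om' I J I' J'| <= eps.
Proof.
move=> e0 small; pose W := wordsle n.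
pose TT (om om' : signs N) := \sum_(I <- W) \sum_(J <- W) \sum_(I' <- W) \sum_(J' <- W)
  pairing_err om om' I J I' J' ^+ 2.
have cst (c : R) : \sum_(I <- W) c = (size W)%:R * c.
  by rewrite big_const_seq count_predT iter_addr_0 -[_ *+ _]mulr_natr mulrC.
have : mean (fun om' => mean (fun om => TT om om')) < eps ^+ 2.
  apply: le_lt_trans small; rewrite /TT.
  have -> : (size W)%:R ^+ 4 * (40 * (M ^+ 2 * q)) =
      \sum_(I <- W) \sum_(J <- W) \sum_(I' <- W) \sum_(J' <- W) (40 * (M ^+ 2 * q)).
    by rewrite !cst; ring.
  have sw (F : word -> signs N -> signs N -> R) :
    mean (fun om' => mean (fun om => \sum_(I <- W) F I om om')) =
    \sum_(I <- W) mean (fun om' => mean (fun om => F I om om')).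
    by under eq_mean do rewrite mean_sum; rewrite mean_sum.
  rewrite sw; apply: ler_sum_seq => I; rewrite mem_wordsle => In.
  rewrite sw; apply: ler_sum_seq => J; rewrite mem_wordsle => Jn.
  rewrite sw; apply: ler_sum_seq => I'; rewrite mem_wordsle => I'n.
  rewrite sw; apply: ler_sum_seq => J'; rewrite mem_wordsle => J'n.
  exact: mean_pairing_err.
move=> /mean_exists[om' /mean_exists[om TTe]]; exists om, om' => I J I' J' In Jn I'n J'n.
have H0 I1 J1 I1' : 0 <= \sum_(J' <- W) pairing_err om om' I1 J1 I1' J' ^+ 2.
  by apply: sumr_ge0 => *; exact: sqr_ge0.
have H1 I1 J1 : 0 <= \sum_(I' <- W) \sum_(J' <- W) pairing_err om om' I1 J1 I' J' ^+ 2.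
  by apply: sumr_ge0 => *; exact: H0.
have H2 I1 : 0 <= \sum_(J <- W) \sum_(I' <- W) \sum_(J' <- W) pairing_err om om' I1 J I' J' ^+ 2.
  by apply: sumr_ge0 => *; exact: H1.
have IW : I \in W by rewrite mem_wordsle.
have JW : J \in W by rewrite mem_wordsle.
have I'W : I' \in W by rewrite mem_wordsle.
have J'W : J' \in W by rewrite mem_wordsle.
have := le_sum_term IW H2; have := le_sum_term JW (H1 I).
have := le_sum_term I'W (H0 I J).
have := @le_sum_term _ _ _ (fun J' => pairing_err om om' I J I' J' ^+ 2) _ J'W (fun=> sqr_ge0 _).
move=> h1 h2 h3 h4; have := le_lt_trans (le_trans (le_trans (le_trans h1 h2) h3) h4) TTe.
rewrite -[X in X < _]real_normK ?num_real// ltr_pXn2r ?nnegrE// ?(ltW e0)//.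
exact: ltW.
Qed.

End Core.

(** * Square functions and operator norms *)

Section L2.
Variables (R : realType) (T : finType).
Implicit Types a b : T -> R.

Definition l2 a : R := Num.sqrt (\sum_i a i ^+ 2).

Lemma l2_ge0 a : 0 <= l2 a. Proof. exact: sqrtr_ge0. Qed.

Lemma l2_sq a : l2 a ^+ 2 = \sum_i a i ^+ 2.
Proof. by rewrite sqr_sqrtr// sumr_ge0// => i _; exact: sqr_ge0. Qed.

Lemma l2_le a b : (forall i, `|a i| <= `|b i|) -> l2 a <= l2 b.
Proof.
move=> ab; rewrite ler_sqrt ?sumr_ge0//; last by move=> i _; exact: sqr_ge0.
apply: ler_sum => i _; rewrite -[a i ^+ 2]real_normK ?num_real//.
by rewrite -[b i ^+ 2]real_normK ?num_real// lerXn2r ?nnegrE.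
Qed.

Lemma cauchy_schwarz a b : \sum_i a i * b i <= l2 a * l2 b.
Proof.
have key : (\sum_i a i * b i) ^+ 2 <= (l2 a * l2 b) ^+ 2.
  rewrite exprMn !l2_sq expr2 -subr_ge0.
  suff -> : (\sum_i a i ^+ 2) * (\sum_i b i ^+ 2) - (\sum_i a i * b i) * (\sum_i a i * b i) =
    2^-1 * \sum_i \sum_j (a i * b j - a j * b i) ^+ 2.
    rewrite mulr_ge0// ?invr_ge0//; apply: sumr_ge0 => i _; apply: sumr_ge0 => j _.
    exact: sqr_ge0.
  have P (u v : T -> R) : (\sum_i u i) * (\sum_i v i) = \sum_i \sum_j u i * v j.
    by rewrite mulr_suml; apply: eq_bigr => i _; rewrite mulr_sumr.
  have -> : \sum_i \sum_j (a i * b j - a j * b i) ^+ 2 =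
    \sum_i \sum_j a i ^+ 2 * b j ^+ 2 + \sum_i \sum_j b i ^+ 2 * a j ^+ 2 -
    (\sum_i \sum_j a i * b i * (a j * b j)) *+ 2.
    rewrite -sumrMnl -big_split -sumrB/=; apply: eq_bigr => i _.
    rewrite -sumrMnl -big_split -sumrB/=; apply: eq_bigr => j _; ring.
  rewrite -!P; set s := \sum_i a i ^+ 2; set t := \sum_i b i ^+ 2.
  by set w := \sum_i a i * b i; field.
apply: le_trans (ler_norm _) _.
rewrite -ler_sqr ?nnegrE ?mulr_ge0 ?l2_ge0//.
by rewrite real_normK ?num_real.
Qed.

Lemma l2D a b : l2 (fun i => a i + b i) <= l2 a + l2 b.
Proof.
rewrite -[leRHS]ger0_norm ?addr_ge0 ?l2_ge0// -ler_sqr ?nnegrE ?l2_ge0 ?normr_ge0//.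
rewrite real_normK ?num_real// sqrrD !l2_sq.
have -> : \sum_i (a i + b i) ^+ 2 =
    \sum_i a i ^+ 2 + (\sum_i a i * b i) *+ 2 + \sum_i b i ^+ 2.
  rewrite -sumrMnl -!big_split/=; apply: eq_bigr => i _; exact: sqrrD.
by rewrite lerD2r lerD2l lerMn2r/= cauchy_schwarz.
Qed.

Lemma l2_sum (S : Type) (s : seq S) (F : S -> T -> R) :
  l2 (fun i => \sum_(x <- s) F x i) <= \sum_(x <- s) l2 (F x).
Proof.
elim: s => [|x s IH].
  rewrite big_nil /l2 big1 ?sqrtr0// => i _; by rewrite big_nil expr0n.
rewrite big_cons; apply: le_trans (lerD (lexx _) IH).
apply: le_trans (l2D _ _).
by rewrite le_eqVlt; apply/orP; left; apply/eqP; congr Num.sqrt;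
  apply: eq_bigr => i _; rewrite big_cons.
Qed.

End L2.

Section SquareFunction.
Variable R : realType.
Implicit Types c d : word -> word -> R.

Lemma square_fun_l2 n c x y :
  square_fun n c x y = l2 (fun ij : 'I_n.+1 * 'I_n.+1 => c (anc ij.1 x) (anc ij.2 y)).
Proof. by rewrite /square_fun /l2 pair_bigA. Qed.

Lemma square_fun_ext n c d x y : (n <= size x)%N -> (n <= size y)%N ->
  (forall u v, (size u <= n)%N -> (size v <= n)%N -> c u v = d u v) ->
  square_fun n c x y = square_fun n d x y.
Proof.
move=> nx ny cd; congr Num.sqrt; apply: eq_bigr => i _; apply: eq_bigr => j _.
have := ltn_ord i; have := ltn_ord j => jn iN.
by rewrite cd ?size_anc//; lia.
Qed.

Lemma grid_avg_le p (F G : word -> word -> R) :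
  (forall x y, size x = p -> size y = p -> F x y <= G x y) -> grid_avg p F <= grid_avg p G.
Proof.
move=> FG; have p0 : 0 < 2 ^- p :> R by rewrite invr_gt0 exprn_gt0.
rewrite ler_pM2l//; apply: ler_sum_seq => x /size_mem_words xp.
by rewrite ler_pM2l//; apply: ler_sum_seq => y /size_mem_words yp; exact: FG.
Qed.

Lemma grid_avgD p (F G : word -> word -> R) :
  grid_avg p (fun x y => F x y + G x y) = grid_avg p F + grid_avg p G.
Proof.
rewrite /grid_avg -mulrDr -big_split/=; congr (_ * _); apply: eq_bigr => x _.
by rewrite -mulrDr -big_split.
Qed.

Lemma grid_avgZ p (k : R) (F : word -> word -> R) :
  grid_avg p (fun x y => k * F x y) = k * grid_avg p F.
Proof.
rewrite /grid_avg [RHS]mulrCA [X in _ = _ * X]mulr_sumr; congr (_ * _); apply: eq_bigr => x _.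
by rewrite [RHS]mulrCA [X in _ = _ * X]mulr_sumr.
Qed.

Lemma grid_avg_anc p k l (F : word -> word -> R) : (k <= p)%N -> (l <= p)%N ->
  grid_avg p (fun x y => F (anc k x) (anc l y)) =
  2 ^- k * \sum_(K <- words k) (2 ^- l * \sum_(L <- words l) F K L).
Proof.
have H i : (i <= p)%N -> 2 ^- p * 2 ^+ (p - i) = 2 ^- i :> R.
  have n0 j : 2 ^+ j != 0 :> R by rewrite expf_neq0// pnatr_eq0.
  by move=> ip; rewrite -{1}(subnK ip) exprD; field; rewrite !n0.
move=> kp lp; rewrite /grid_avg.
under eq_bigr => x _ do rewrite (sum_anc (F (anc k x)) lp) mulrA H//.
by rewrite (sum_anc (fun K => 2 ^- l * \sum_(L <- words l) F K L) kp) mulrA H.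
Qed.

Lemma grid_avg_cst p (k : R) : grid_avg p (fun _ _ => k) = k.
Proof.
rewrite (@grid_avg_anc p 0 0 (fun _ _ => k))// !sum_words0 expr0.
by rewrite invr1 !mul1r.
Qed.

Lemma H1norm_ge0 n (f : H1 R n) : 0 <= H1norm f.
Proof.
rewrite (H1norm_grid_avg f (leqnn n)) -[leLHS](grid_avg_cst n 0).
by apply: grid_avg_le => *; exact: square_fun_ge0.
Qed.

Lemma H1normZ n k (f : H1 R n) : H1norm (k *: f : H1 R n) = `|k| * H1norm f.
Proof.
rewrite !(H1norm_grid_avg _ (leqnn n)) -grid_avgZ; congr (2 ^- n * _).
apply: eq_bigr => x _; congr (_ * _); apply: eq_bigr => y _.
rewrite /square_fun -sqrtr_sqr -sqrtrM ?sqr_ge0//; congr Num.sqrt.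
rewrite mulr_sumr; apply: eq_bigr => i _; rewrite mulr_sumr; apply: eq_bigr => j _.
by rewrite hcoefZ exprMn.
Qed.

Lemma square_fun_ge n c x y i j : (i <= n)%N -> (j <= n)%N ->
  `|c (anc i x) (anc j y)| <= square_fun n c x y.
Proof.
move=> iN jN; rewrite square_fun_l2 -ler_sqr ?nnegrE ?l2_ge0// l2_sq real_normK ?num_real//.
rewrite (bigD1 (inord i, inord j))//= !inordK// lerDl sumr_ge0// => ? _.
exact: sqr_ge0.
Qed.

(** On one level the square function dominates the absolute value of the
    coefficient at each point. *)
Lemma sum_hcoef_le n k l (f : H1 R n) : (k <= n)%N -> (l <= n)%N ->
  2 ^- k * \sum_(K <- words k) (2 ^- l * \sum_(L <- words l) `|hcoef f K L|) <= H1norm f.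
Proof.
move=> kn ln; rewrite (H1norm_grid_avg f (leqnn n)).
rewrite -(grid_avg_anc (fun K L => `|hcoef f K L|) kn ln).
by apply: grid_avg_le => x y _ _; exact: square_fun_ge.
Qed.

Lemma hcoef_le n (f : H1 R n) K L : (size K <= n)%N -> (size L <= n)%N ->
  `|hcoef f K L| <= 2 ^+ size K * 2 ^+ size L * H1norm f.
Proof.
move=> Kn Ln; have := sum_hcoef_le f Kn Ln.
have q0 i : 0 < 2 ^+ i :> R by rewrite exprn_gt0.
rewrite -mulr_sumr mulrA -invfM => H.
rewrite -ler_pdivrMl ?mulr_gt0//; apply: le_trans H.
rewrite ler_pM2l ?invr_gt0 ?mulr_gt0//.
have H0 : forall K', 0 <= \sum_(L' <- words (size L)) `|hcoef f K' L'|.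
  by move=> K'; apply: sumr_ge0.
apply: le_trans (le_sum_term (x := K) _ H0); last by rewrite mem_words.
apply: (@le_sum_term _ _ (words (size L)) (fun L' => `|hcoef f K L'|) L) => //.
by rewrite mem_words.
Qed.

Lemma H1norm_haar_elt n K L : (size K <= n)%N -> (size L <= n)%N ->
  H1norm (haar_elt R n K L) = 2 ^- size K * 2 ^- size L.
Proof.
move=> Kn Ln; rewrite (H1norm_grid_avg _ (leqnn n)).
transitivity (grid_avg n (fun x y =>
    (anc (size K) x == K)%:R * (anc (size L) y == L)%:R : R)); last first.
  rewrite (grid_avg_anc (fun K' L' => (K' == K)%:R * (L' == L)%:R))//.
  have pick M : \sum_(u <- words (size M)) (u == M)%:R = 1 :> R.
    rewrite -[RHS](@sum_words_pick _ (size M) (fun=> 1) M)//.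
    by apply: eq_bigr => u _; case: eqP.
  under eq_bigr do rewrite -mulr_sumr pick mulr1.
  by rewrite -mulr_sumr pick mulr1.
congr (_ * _); apply: eq_big_seq => x /size_mem_words xn; congr (_ * _).
apply: eq_big_seq => y /size_mem_words yn.
have pick M z : size z = n -> (size M <= n)%N ->
    \sum_(i < n.+1) (anc i z == M)%:R = (anc (size M) z == M)%:R :> R.
  move=> zn Mn; rewrite (bigD1 (inord (size M)))//= inordK// big1 ?addr0// => i.
  rewrite -val_eqE /= inordK// => iM; case: eqP => // E.
  have := ltn_ord i; rewrite ltnS => iN.
  by move: iM; rewrite -E size_anc ?zn// eqxx.
rewrite /square_fun (_ : \sum_(i < n.+1) _ = ((anc (size K) x == K)%:R * (anc (size L) y == L)%:R) ^+ 2).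
  by rewrite sqrtr_sqr ger0_norm// mulr_ge0.
rewrite exprMn !sqr_natb -(pick K x xn Kn) -(pick L y yn Ln) mulr_suml.
apply: eq_bigr => i _; rewrite mulr_sumr; apply: eq_bigr => j _.
have := ltn_ord i; have := ltn_ord j => jn iN.
rewrite hcoef_of_coefs ?size_anc ?xn ?yn//.
by rewrite sqr_natb -natrM mulnb.
Qed.

Lemma H1norm_eq0 n (f : H1 R n) : H1norm f = 0 -> f = 0.
Proof.
move=> f0; apply: hcoef_ext => u v un vn; rewrite hcoef0.
have := hcoef_le f un vn; rewrite f0 mulr0 normr_le0; exact/eqP.
Qed.

Lemma opnorm_bound m n (T : {linear H1 R m -> H1 R n}) M : (opnorm T <= M%:E)%E ->
  forall f : H1 R m, H1norm f <= 1 -> H1norm (T f) <= M.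
Proof.
move=> TM f f1; rewrite -lee_fin; apply: le_trans TM.
by apply: ereal_sup_ubound; exists f.
Qed.

Lemma opnorm_le m n (T : H1 R m -> H1 R n) (M : R) :
  (forall f : H1 R m, H1norm f <= 1 -> H1norm (T f) <= M) -> (opnorm T <= M%:E)%E.
Proof.
by move=> H; apply: ge_ereal_sup => _ [f f1 <-]; rewrite lee_fin; exact: H.
Qed.

Lemma opnorm_ge0 m n (T : {linear H1 R m -> H1 R n}) : (0 <= opnorm T)%E.
Proof.
have n0 k : H1norm (0 : H1 R k) = 0.
  by rewrite -(scale0r (0 : H1 R k)) H1normZ normr0 mul0r.
apply: ereal_sup_ubound; exists 0; first by rewrite /= n0.
by rewrite linear0 n0.
Qed.

(** This is all that the choice of signs needs to know about the operator norm of
    [T]: [T] maps the function of norm |K||L| to a function of norm at most M|K||L|,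
    and the coefficients on one level are summable against that norm. *)
Lemma matrix_row_bound N (T : {linear H1 R N -> H1 R N}) M : (opnorm T <= M%:E)%E ->
  forall K L k' l', (size K <= N)%N -> (size L <= N)%N -> (k' <= N)%N -> (l' <= N)%N ->
  \sum_(K' <- words k') \sum_(L' <- words l')
    `|hcoef (T (haar_elt R N K L)) K' L' * (2 ^- size K' * 2 ^- size L')|
    <= M * (2 ^- size K * 2 ^- size L).
Proof.
move=> TM K L k' l' KN LN k'N l'N.
have q0 i : 0 < 2 ^+ i :> R by rewrite exprn_gt0.
pose s : R := 2 ^+ size K * 2 ^+ size L.
have s0 : 0 < s by rewrite mulr_gt0.
have : H1norm (T (s *: haar_elt R N K L)) <= M.
  apply: (opnorm_bound TM); rewrite H1normZ H1norm_haar_elt// -invfM gtr0_norm//.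
  by rewrite divff// gt_eqF.
rewrite linearZ H1normZ gtr0_norm// mulrC -ler_pdivlMr// /s invfM.
apply: le_trans; apply: le_trans (sum_hcoef_le _ k'N l'N).
rewrite mulr_sumr; apply: ler_sum_seq => K' /size_mem_words K'k.
rewrite !mulr_sumr; apply: ler_sum_seq => L' /size_mem_words L'l.
have E : `|2 ^- k' * 2 ^- l' : R| = 2 ^- k' * 2 ^- l'.
  by rewrite ger0_norm// -invfM invr_ge0 mulr_ge0// ltW.
by rewrite K'k L'l normrM mulrC mulrA E.
Qed.

End SquareFunction.

(** * The block basis: isometric embedding and contractive projection *)

Section Embedding.
Variables (R : realType) (N n : nat).

Definition block_emb_coef ks ls (om om' : signs N) (c : word -> word -> R)
  (K L : word) : R :=
  if (size K \in ks) && (size L \in ls) then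
    hsign R om K * (hsign R om' L * c (label ks (sbit om) K) (label ls (sbit om') L))
  else 0.

(** The operator h_{IxJ} |-> b_{IxJ}. In the coordinates of [block_emb_coef] the
    interval [K] is charged with the coefficient of the only block it belongs to. *)
Definition block_emb ks ls om om' (f : H1 R n) : H1 R N :=
  of_coefs N (block_emb_coef ks ls om om' (hcoef f)).

Definition block_prj_coef ks ls (om om' : signs N) (c : word -> word -> R)
  (I J : word) : R :=
  2 ^+ size I * 2 ^+ size J *
  \sum_(K <- words (level ks (size I))) \sum_(L <- words (level ls (size J)))
    blk ks R om I K * (blk ls R om' J L * (2 ^- size K * (2 ^- size L * c K L))).

(** The operator g |-> sum of (<g, b_{IxJ}> / |IxJ|) h_{IxJ}. *)
Definition block_prj ks ls om om' (g : H1 R N) : H1 R n :=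
  of_coefs n (block_prj_coef ks ls om om' (hcoef g)).

Lemma block_emb_linear ks ls om om' : linear (block_emb ks ls om om').
Proof.
move=> k f g; apply: of_coefs_lin => u v; rewrite /block_emb_coef; case: ifP => _.
  by rewrite hcoef_lin; ring.
by rewrite mulr0 addr0.
Qed.

HB.instance Definition _ ks ls om om' :=
  GRing.isLinear.Build R (H1 R n) (H1 R N) *:%R (block_emb ks ls om om')
    (@block_emb_linear ks ls om om').

Lemma block_prj_linear ks ls om om' : linear (block_prj ks ls om om').
Proof.
move=> k f g; apply: of_coefs_lin => u v; rewrite /block_prj_coef.
rewrite mulrCA -mulrDr; congr (_ * _).
rewrite mulr_sumr -big_split/=; apply: eq_bigr => K _.
rewrite mulr_sumr -big_split/=; apply: eq_bigr => L _.
by rewrite hcoef_lin; ring.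
Qed.

HB.instance Definition _ ks ls om om' :=
  GRing.isLinear.Build R (H1 R N) (H1 R n) *:%R (block_prj ks ls om om')
    (@block_prj_linear ks ls om om').

Variables (q : R) (ks ls : seq nat) (om om' : signs N).
Hypotheses (gk : admissible N n q ks) (gl : admissible N n q ls).

Lemma sum_level (V : nmodType) ms (G : nat -> V) : admissible N n q ms ->
  \sum_(k < N.+1) (if nat_of_ord k \in ms then G k else 0) = \sum_(i < n.+1) G (level ms i).
Proof.
move=> gm; case: (gm) => ss sz mN _.
rewrite -(big_mkord xpredT (fun k => if k \in ms then G k else 0)) -big_mkcond.
rewrite -big_filter.
transitivity (\sum_(k <- ms) G k).
  apply: perm_big; apply: uniq_perm.
  - by rewrite filter_uniq// iota_uniq.
  - exact: admissible_uniq gm.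
  move=> k; rewrite mem_filter mem_index_iota.
  by apply/andP/idP => [[]//|km]; split=> //; rewrite /= ltnS mN.
by rewrite (big_nth 0%N) sz big_mkord.
Qed.

Lemma depth_admissible_max ms : admissible N n q ms -> depth ms N.+1 = n.+1.
Proof.
move=> gm; case: (gm) => _ sz mN _; rewrite /depth -sz; apply/eqP; rewrite -all_count.
by apply/allP => k km; rewrite /= ltnS mN.
Qed.

(* one level finer than all blocks, so that the labels of the points have all
   n + 1 bits *)
Let p := N.+1.

(** Up to signs, the coefficients seen at (x, y) are those of the original function
    at the labels of x and y. *)
Lemma square_fun_emb c x y : size x = p -> size y = p ->
  square_fun N (block_emb_coef ks ls om om' c) x y =
  square_fun n c (label ks (sbit om) x) (label ls (sbit om') y).
Proof.
move=> xp yp; congr Num.sqrt.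
have uk := admissible_uniq gk; have ul := admissible_uniq gl.
pose G k l := c (anc (depth ks k) (label ks (sbit om) x)) (anc (depth ls l) (label ls (sbit om') y)) ^+ 2.
transitivity (\sum_(k < N.+1) if nat_of_ord k \in ks then
   \sum_(l < N.+1) (if nat_of_ord l \in ls then G k l else 0) else 0).
  apply: eq_bigr => k _.
  have kp : (k <= size x)%N by rewrite xp ltnW// ltn_ord.
  rewrite /block_emb_coef size_anc//; case: ifP => kk /=; last first.
    by rewrite big1// => l _; rewrite expr0n.
  apply: eq_bigr => l _.
  have lp : (l <= size y)%N by rewrite yp ltnW// ltn_ord.
  rewrite size_anc//; case: ifP => ll; last by rewrite expr0n.
  by rewrite !exprMn !expr2 !hsign_sq !mul1r /G !label_anc.
rewrite (sum_level (fun k => \sum_(l < N.+1) (if nat_of_ord l \in ls then G k l else 0)) gk).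
apply: eq_bigr => i _; rewrite (sum_level (G (level ks i)) gl); apply: eq_bigr => j _.
by rewrite /G !(depth_admissible gk, depth_admissible gl)// -ltnS ltn_ord.
Qed.

Lemma grid_avg_label (F : word -> word -> R) :
  grid_avg p (fun x y => F (label ks (sbit om) x) (label ls (sbit om') y)) = grid_avg n.+1 F.
Proof.
have n0 i : 2 ^+ i != 0 :> R by rewrite expf_neq0// pnatr_eq0.
rewrite /grid_avg.
under eq_bigr => x _ do rewrite (sum_label _ (admissible_uniq gl) p (F (label ks (sbit om) x))).
rewrite (sum_label _ (admissible_uniq gk) p (fun u => 2 ^- p * (2 ^+ p / 2 ^+ depth ls p *
  \sum_(y <- words (depth ls p)) F u y))).
rewrite (depth_admissible_max gk) (depth_admissible_max gl) mulrA mulKf//; congr (_ * _).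
by apply: eq_bigr => x _; rewrite mulrA mulKf.
Qed.

Lemma H1norm_block_emb f : H1norm (block_emb ks ls om om' f) = H1norm f.
Proof.
rewrite (H1norm_grid_avg _ (leqnSn N)) (H1norm_grid_avg f (leqnSn n)) -grid_avg_label.
have Hle : forall F G : word -> word -> R,
   (forall x y, size x = p -> size y = p -> F x y = G x y) ->
   grid_avg p F = grid_avg p G.
  move=> F G FG; congr (_ * _); apply: eq_big_seq => x /size_mem_words xp.
  by congr (_ * _); apply: eq_big_seq => y /size_mem_words yp; exact: FG.
apply: Hle => x y xp yp; rewrite -square_fun_emb//.
by apply: square_fun_ext => [||u v un vn]; rewrite ?xp ?yp ?leqnSn// hcoef_of_coefs.
Qed.

Lemma cond_natb (T : Type) (s : seq T) (P : pred T) (F : T -> R) :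
  \sum_(x <- s) (P x)%:R * F x = \sum_(x <- s | P x) F x.
Proof.
by rewrite [RHS]big_mkcond; apply: eq_bigr => x _; case: (P x); rewrite ?mul1r ?mul0r.
Qed.

Lemma normr_blk_eq ms (th : signs N) I K :
  `|blk ms R th I K| = (label ms (sbit th) K == I)%:R.
Proof. by rewrite normrM normr_hsign mul1r normr_nat. Qed.

(** The coefficient at IxJ is bounded by the average of the coefficients of the
    members of the block. By homogeneity this is an average over the points with
    label (u, v), the same set of points for all ancestors I of u and J of v. *)
Lemma block_prj_coef_le c u v i j : size u = n.+1 -> size v = n.+1 ->
  (i <= n)%N -> (j <= n)%N ->
  `|block_prj_coef ks ls om om' c (anc i u) (anc j v)| <=
  (2 ^+ n.+1 / 2 ^+ p) ^+ 2 * \sum_(x <- words p | label ks (sbit om) x == u)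
    \sum_(y <- words p | label ls (sbit om') y == v)
      `|c (anc (level ks i) x) (anc (level ls j) y)|.
Proof.
move=> un vn iN jN.
have uk := admissible_uniq gk; have ul := admissible_uniq gl.
have q0 m : 0 <= 2 ^- m :> R by rewrite invr_ge0 exprn_ge0.
have ki : (level ks i <= p)%N by apply: leqW; exact: level_le gk iN.
have lj : (level ls j <= p)%N by apply: leqW; exact: level_le gl jN.
have Hk (g : word -> R) := sum_label_anc (sbit om) uk g ki (etrans un (esym (depth_admissible_max gk))).
have Hl (g : word -> R) := sum_label_anc (sbit om') ul g lj (etrans vn (esym (depth_admissible_max gl))).
rewrite (depth_admissible_max gk) (depth_admissible gk iN) in Hk.
rewrite (depth_admissible_max gl) (depth_admissible gl jN) in Hl.
set k := level ks i in Hk *; set l := level ls j in Hl *.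
set z := 2 ^+ n.+1 / 2 ^+ p in Hk Hl *.
have -> : z ^+ 2 * \sum_(x <- words p | label ks (sbit om) x == u)
    \sum_(y <- words p | label ls (sbit om') y == v) `|c (anc k x) (anc l y)| =
  z * \sum_(x <- words p | label ks (sbit om) x == u)
   (2 ^+ j / 2 ^+ l * \sum_(L <- words l | label ls (sbit om') L == anc j v) `|c (anc k x) L|).
  rewrite expr2 -mulrA mulr_sumr; congr (_ * _); apply: eq_bigr => x _.
  by rewrite (Hl (fun L => `|c (anc k x) L|)).
rewrite (Hk (fun K => 2 ^+ j / 2 ^+ l * \sum_(L <- words l | label ls (sbit om') L == anc j v) `|c K L|)).
rewrite /block_prj_coef !size_anc ?un ?vn ?leqW// -/k -/l.
rewrite normrM (ger0_norm (_ : 0 <= 2 ^+ i * 2 ^+ j)) ?mulr_ge0 ?exprn_ge0//.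
rewrite -[leLHS]mulrA -[leRHS]mulrA ler_pM2l ?exprn_gt0//.
apply: (@le_trans _ _ (2 ^+ j * \sum_(K <- words k) \sum_(L <- words l)
   (label ks (sbit om) K == anc i u)%:R * ((label ls (sbit om') L == anc j v)%:R *
    (2 ^- k * (2 ^- l * `|c K L|))))).
  rewrite ler_pM2l ?exprn_gt0//; apply: le_trans (ler_norm_sum _ _ _) _.
  apply: ler_sum_seq => K /size_mem_words Kk; apply: le_trans (ler_norm_sum _ _ _) _.
  apply: ler_sum_seq => L /size_mem_words Ll.
  rewrite normrM normr_blk_eq normrM normr_blk_eq Kk Ll normrM (ger0_norm (q0 k)).
  by rewrite normrM (ger0_norm (q0 l)).
rewrite le_eqVlt; apply/orP; left; apply/eqP.
rewrite -(cond_natb _ (fun K => label ks (sbit om) K == anc i u)) [LHS]mulr_sumr [RHS]mulr_sumr.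
apply: eq_bigr => K _; rewrite -(cond_natb _ (fun L => label ls (sbit om') L == anc j v)).
rewrite !mulr_sumr; apply: eq_bigr => L _; ring.
Qed.

(** Minkowski's inequality: the Euclidean norm of an average is at most the average
    of the norms. It applies because all coefficients at (u, v) are averages over one
    and the same set. *)
Lemma square_fun_prj c u v : size u = n.+1 -> size v = n.+1 ->
  square_fun n (block_prj_coef ks ls om om' c) u v <=
  (2 ^+ n.+1 / 2 ^+ p) ^+ 2 * \sum_(x <- words p | label ks (sbit om) x == u)
    \sum_(y <- words p | label ls (sbit om') y == v) square_fun N c x y.
Proof.
move=> un vn; set z := (_ / _) ^+ 2.
have z0 : 0 <= z by exact: sqr_ge0.
pose a x y (ij : 'I_n.+1 * 'I_n.+1) : R := `|c (anc (level ks ij.1) x) (anc (level ls ij.2) y)|.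
have aS x y : l2 (a x y) <= square_fun N c x y.
  rewrite ler_sqrt; last by apply: sumr_ge0 => *; apply: sumr_ge0 => *; exact: sqr_ge0.
  rewrite -(pair_bigA _ (fun i j : 'I_n.+1 => a x y (i, j) ^+ 2))/=.
  rewrite -(sum_level (fun k => \sum_(j < n.+1) `|c (anc k x) (anc (level ls j) y)| ^+ 2) gk).
  apply: ler_sum => k _; case: ifP => _; last first.
    by apply: sumr_ge0 => *; exact: sqr_ge0.
  rewrite -(sum_level (fun l => `|c (anc k x) (anc l y)| ^+ 2) gl).
  apply: ler_sum => l _; case: ifP => _; last exact: sqr_ge0.
  by rewrite real_normK ?num_real.
have l2Z (b : 'I_n.+1 * 'I_n.+1 -> R) : l2 (fun t => z * b t) = z * l2 b.
  rewrite /l2; under eq_bigr do rewrite exprMn.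
  by rewrite -mulr_sumr sqrtrM ?sqr_ge0// sqrtr_sqr ger0_norm.
rewrite square_fun_l2.
apply: (@le_trans _ _ (l2 (fun ij => z * \sum_(x <- words p | label ks (sbit om) x == u)
    \sum_(y <- words p | label ls (sbit om') y == v) a x y ij))).
  apply: l2_le => -[i j]; rewrite [leRHS]ger0_norm; last first.
    by rewrite mulr_ge0//; apply: sumr_ge0 => *; apply: sumr_ge0 => *; exact: normr_ge0.
  by apply: block_prj_coef_le => //; rewrite -ltnS ltn_ord.
rewrite l2Z ler_wpM2l//.
rewrite -big_filter; under [X in l2 X]eq_fun do rewrite -big_filter.
apply: le_trans (l2_sum _ _) _; apply: ler_sum => x _.
rewrite -big_filter; under [X in l2 X]eq_fun do rewrite -big_filter.
apply: le_trans (l2_sum _ _) _; apply: ler_sum => y _.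
exact: aS.
Qed.

(** Summation of [square_fun_prj] over the labels, which partition the grid. *)
Lemma H1norm_block_prj g : H1norm (block_prj ks ls om om' g) <= H1norm g.
Proof.
have n0 i : 2 ^+ i != 0 :> R by rewrite expf_neq0// pnatr_eq0.
have part ms (th : signs N) (F : word -> R) : admissible N n q ms ->
    \sum_(x <- words p) F x =
    \sum_(u <- words n.+1) \sum_(x <- words p | label ms (sbit th) x == u) F x.
  move=> gm; transitivity (\sum_(x <- words p) \sum_(u <- words n.+1)
      if u == label ms (sbit th) x then F x else 0).
    apply: eq_big_seq => x /size_mem_words xp.
    rewrite (@sum_words_pick _ n.+1 (fun=> F x))// size_label ?(admissible_uniq gm)//.
    by rewrite xp depth_admissible_max.
  rewrite exchange_big/=; apply: eq_bigr => u _; rewrite [RHS]big_mkcond.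
  by apply: eq_bigr => x _; rewrite eq_sym.
have -> : H1norm g = grid_avg n.+1 (fun u v => (2 ^+ n.+1 / 2 ^+ p) ^+ 2 *
   \sum_(x <- words p | label ks (sbit om) x == u)
    \sum_(y <- words p | label ls (sbit om') y == v) square_fun N (hcoef g) x y).
  rewrite (H1norm_grid_avg g (leqnSn N)) grid_avgZ /grid_avg (part _ om _ gk).
  rewrite -/p; under eq_bigr do under eq_bigr do rewrite (part _ om' _ gl).
  rewrite -[in RHS]mulr_sumr.
  under [in LHS]eq_bigr do rewrite -mulr_sumr exchange_big/=.
  by rewrite -mulr_sumr; field; rewrite !n0.
rewrite (H1norm_grid_avg _ (leqnSn n)); apply: grid_avg_le => u v un vn.
apply: le_trans (square_fun_prj (hcoef g) un vn); rewrite le_eqVlt; apply/orP; left; apply/eqP.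
by apply: square_fun_ext => [||u' v' u'n v'n]; rewrite ?un ?vn// hcoef_of_coefs.
Qed.

Lemma sum_block_emb (V : lmodType R) ms (th : signs N) (G : word -> word -> V) :
  admissible N n q ms ->
  \sum_(K <- wordsle N)
    (if size K \in ms then hsign R th K *: G (label ms (sbit th) K) K else 0) =
  \sum_(I <- wordsle n) \sum_(K <- words (level ms (size I))) blk ms R th I K *: G I K.
Proof.
move=> gm; rewrite !sum_wordsle.
transitivity (\sum_(k < N.+1) if nat_of_ord k \in ms then
   \sum_(K <- words k) hsign R th K *: G (label ms (sbit th) K) K else 0).
  apply: eq_bigr => k _; case: ifP => kk.
    by apply: eq_big_seq => K /size_mem_words Kk; rewrite Kk kk.
  by rewrite big_seq big1// => K /size_mem_words Kk; rewrite Kk kk.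
rewrite (sum_level (fun k => \sum_(K <- words k) hsign R th K *: G (label ms (sbit th) K) K) gm).
apply: eq_bigr => i _.
have iN : (i <= n)%N by rewrite -ltnS ltn_ord.
transitivity (\sum_(I <- words i) \sum_(K <- words (level ms i)) blk ms R th I K *: G I K); last first.
  by apply: eq_big_seq => I /size_mem_words ->.
rewrite exchange_big/=; apply: eq_big_seq => K /size_mem_words Kk.
rewrite -[LHS](@sum_words_pick _ i (fun I => hsign R th K *: G I K)).
  apply: eq_bigr => I _; rewrite /blk eq_sym; case: eqP => _.
    by rewrite mulr1.
  by rewrite mulr0 scale0r.
by rewrite size_label ?(admissible_uniq gm)// Kk (depth_admissible gm).
Qed.

(** Change of the order of summation: a sum against the coefficients of the image
    of [f] is a sum over the blocks. *)
Lemma sum_block_emb2 f (X : word -> word -> R) :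
  \sum_(K <- wordsle N) \sum_(L <- wordsle N) hcoef (block_emb ks ls om om' f) K L * X K L =
  \sum_(I <- wordsle n) \sum_(J <- wordsle n) hcoef f I J *
    \sum_(K <- words (level ks (size I))) \sum_(L <- words (level ls (size J)))
      blk ks R om I K * (blk ls R om' J L * X K L).
Proof.
pose G1 I K : R := \sum_(L <- wordsle N) (if size L \in ls then
   hsign R om' L *: (hcoef f I (label ls (sbit om') L) * X K L) else 0).
transitivity (\sum_(K <- wordsle N) (if size K \in ks then
   hsign R om K *: (G1 (label ks (sbit om) K) K : R^o) else 0)).
  apply: eq_big_seq => K; rewrite mem_wordsle => KN; case: ifP => kk; last first.
    rewrite big_seq big1// => L; rewrite mem_wordsle => LN.
    by rewrite hcoef_of_coefs// /block_emb_coef kk mul0r.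
  rewrite scaler_sumr; apply: eq_big_seq => L; rewrite mem_wordsle => LN.
  rewrite hcoef_of_coefs// /block_emb_coef kk /=; case: ifP => _; last by rewrite mul0r scaler0.
  by rewrite /GRing.scale/=; ring.
rewrite (sum_block_emb (V := R^o) om G1 gk); apply: eq_bigr => I _.
rewrite /G1; under eq_bigr do rewrite (sum_block_emb (V := R^o) om' (fun J L => hcoef f I J * X _ L) gl).
rewrite /GRing.scale/=; under eq_bigr do rewrite mulr_sumr.
rewrite exchange_big/=; apply: eq_bigr => J _.
rewrite mulr_sumr; apply: eq_bigr => K _.
rewrite !mulr_sumr; apply: eq_bigr => L _; ring.
Qed.

Lemma block_prj_emb f : block_prj ks ls om om' (block_emb ks ls om om' f) = f.
Proof.
have n0 i : 2 ^+ i != 0 :> R by rewrite expf_neq0// pnatr_eq0.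
have H ms (th : signs N) I : admissible N n q ms -> (size I <= n)%N ->
  2 ^+ size I * \sum_(K <- words (level ms (size I))) (label ms (sbit th) K == I)%:R *
     2 ^- level ms (size I) = 1 :> R.
  move=> gm In; have := sum_label_anc (sbit th) (admissible_uniq gm) (fun=> 1 : R) (leq0n (level ms (size I))) (y := I).
  rewrite (depth_admissible gm In) => /(_ erefl).
  rewrite depth0 expr0 divr1 mul1r [RHS]big_mkcond sum_words0 /=.
  rewrite /anc subn0 drop_size eqxx => H1.
  rewrite -mulr_suml -[RHS]H1 mulrAC mulrA -[in RHS]cond_natb.
  by under [in RHS]eq_bigr do rewrite mulr1.
apply: hcoef_ext => I J In Jn; rewrite hcoef_of_coefs// /block_prj_coef.
transitivity (hcoef f I J *
  ((2 ^+ size I * \sum_(K <- words (level ks (size I))) (label ks (sbit om) K == I)%:R *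
     2 ^- level ks (size I)) *
  (2 ^+ size J * \sum_(L <- words (level ls (size J))) (label ls (sbit om') L == J)%:R *
     2 ^- level ls (size J)))); last by rewrite !H// !mulr1.
rewrite mulrACA [RHS]mulrCA; congr (_ * _).
rewrite mulr_suml mulr_sumr; apply: eq_big_seq => K /size_mem_words Kk.
rewrite !mulr_sumr; apply: eq_big_seq => L /size_mem_words Ll.
rewrite Kk Ll hcoef_of_coefs ?Kk ?Ll ?(level_le gk In) ?(level_le gl Jn)//.
rewrite /block_emb_coef Kk Ll (level_mem gk In) (level_mem gl Jn)/= /blk.
case: eqP => [->|_]; last by rewrite !(mul0r,mulr0).
case: eqP => [->|_]; last by rewrite !(mul0r,mulr0).
rewrite (_ : true%:R = 1 :> R)// !mulr1 ?mul1r.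
have := hsign_sq R om K; have := hsign_sq R om' L; set a := hsign _ _ _; set b := hsign _ _ _ => sqL sqK.
set x := 2 ^- level ks _; set y := 2 ^- level ls _; set h := hcoef f I J.
transitivity ((b * b) * (a * a) * (h * (x * y))); first by ring.
by rewrite sqL sqK !mul1r.
Qed.

End Embedding.

(** * Inversion in finite dimension *)

Section Coordinates.
Variables (R : realType) (n : nat).

Definition word_pairs : seq (word * word) :=
  [seq (u, v) | u <- wordsle n, v <- wordsle n].

Definition word_pair (i : 'I_(size word_pairs)) : word * word :=
  nth ([::], [::]) word_pairs i.

Definition to_row (f : H1 R n) : 'rV[R]_(size word_pairs) :=
  \row_i hcoef f (word_pair i).1 (word_pair i).2.

Definition of_row (w : 'rV[R]_(size word_pairs)) : H1 R n :=
  \sum_i w 0 i *: haar_elt R n (word_pair i).1 (word_pair i).2.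

Lemma word_pair_le i : (size (word_pair i).1 <= n)%N /\ (size (word_pair i).2 <= n)%N.
Proof.
have : word_pair i \in word_pairs by apply: mem_nth; exact: ltn_ord.
by move=> /allpairsP[[u v] /= [un vn ->]]; rewrite -!mem_wordsle.
Qed.

Lemma word_pair_inj : injective word_pair.
Proof.
move=> i j ij; apply: val_inj; apply/eqP.
rewrite /= -(nth_uniq ([::], [::]) (ltn_ord i) (ltn_ord j)); first exact/eqP.
by apply: allpairs_uniq; rewrite ?wordsle_uniq// => -[? ?] [? ?].
Qed.

Lemma of_rowK w : to_row (of_row w) = w.
Proof.
apply/rowP => j; have [j1 j2] := word_pair_le j; rewrite mxE hcoef_sum.
under eq_bigr do rewrite hcoefZ hcoef_of_coefs//.
rewrite (bigD1 j)//= big1 ?addr0; first by rewrite !eqxx mulr1.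
move=> i ij.
case: eqP => [E1|_]; last by rewrite mulr0.
case: eqP => [E2|_]; last by rewrite mulr0.
case/eqP: ij; apply: word_pair_inj.
by rewrite [LHS]surjective_pairing [RHS]surjective_pairing -E1 -E2.
Qed.

Lemma to_rowK f : of_row (to_row f) = f.
Proof.
rewrite [RHS]H1_haar_decomp.
transitivity (\sum_(uv <- word_pairs) hcoef f uv.1 uv.2 *: haar_elt R n uv.1 uv.2); last first.
  by rewrite big_allpairs_dep.
rewrite (big_nth ([::], [::])) big_mkord; apply: eq_bigr => i _.
by rewrite mxE.
Qed.

Lemma to_row_linear : linear to_row.
Proof. by move=> k f g; apply/rowP => i; rewrite !mxE hcoef_lin. Qed.

HB.instance Definition _ :=
  GRing.isLinear.Build R (H1 R n) 'rV[R]_(size word_pairs) *:%R to_row to_row_linear.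

Lemma of_row_linear : linear of_row.
Proof.
move=> k f g; rewrite /of_row scaler_sumr -big_split; apply: eq_bigr => i _.
by rewrite !mxE scalerDl scalerA.
Qed.

HB.instance Definition _ :=
  GRing.isLinear.Build R 'rV[R]_(size word_pairs) (H1 R n) *:%R of_row of_row_linear.

Definition op_of_mx (B : 'M[R]_(size word_pairs)) (f : H1 R n) : H1 R n :=
  of_row (to_row f *m B).

Lemma op_of_mx_linear B : linear (op_of_mx B).
Proof. by move=> k f g; rewrite /op_of_mx linearP mulmxDl -scalemxAl linearP. Qed.

HB.instance Definition _ B :=
  GRing.isLinear.Build R (H1 R n) (H1 R n) *:%R (op_of_mx B) (op_of_mx_linear B).

(** In coordinates the operator is a square matrix with trivial kernel. *)
Lemma injective_linear_inverse (S : {linear H1 R n -> H1 R n}) :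
  (forall f, S f = 0 -> f = 0) ->
  exists S' : {linear H1 R n -> H1 R n}, cancel S S' /\ cancel S' S.
Proof.
move=> S0; pose B := lin1_mx (to_row \o S \o of_row).
have BE w : w *m B = to_row (S (of_row w)) by rewrite mul_rV_lin1.
have uB : B \in unitmx.
  rewrite -row_free_unit -kermx_eq0; apply/eqP/row_matrixP => i; rewrite row0.
  have : row i (kermx B) *m B = 0 by rewrite -row_mul mulmx_ker row0.
  rewrite BE => E; rewrite -[LHS]of_rowK.
  have -> : of_row (row i (kermx B)) = 0; last by rewrite linear0.
  by apply: S0; rewrite -[LHS]to_rowK E linear0.
exists (op_of_mx (invmx B)); split=> f; rewrite /= /op_of_mx.
  by rewrite -{1}(to_rowK f) -BE mulmxK// to_rowK.
by rewrite -[LHS]to_rowK -BE mulmxKV// to_rowK.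
Qed.

End Coordinates.

(** * Bipartite Ramsey argument for the levels *)

Section Ramsey.
Implicit Types (chi : nat -> nat -> bool) (s rows : seq nat).

(** Each row halves the set of columns at worst. *)
Lemma refine_columns chi rows s m : (m * 2 ^ size rows <= size s)%N ->
  exists s', [/\ subseq s' s, (m <= size s')%N &
    {in rows, forall k, {in s' &, forall l l', chi k l = chi k l'}}].
Proof.
elim: rows s => [|k rows IH] s /=; first by rewrite muln1 => ?; exists s.
rewrite expnS => ms.
have [b bs] : exists b, (m * 2 ^ size rows <= size [seq l <- s | chi k l == b])%N.
  have := count_predC (fun l => chi k l == true) s.
  have [h|h] := leqP (m * 2 ^ size rows) (size [seq l <- s | chi k l == true]).
    by exists true.
  move=> E; exists false; move: h E; rewrite !size_filter.
  rewrite (eq_count (a1 := fun l => chi k l == false) (a2 := predC (fun l => chi k l == true))).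
    lia.
  by move=> l /=; case: (chi k l).
have [s' [s's ms' cs']] := IH _ bs.
exists s'; split=> //; first exact: subseq_trans s's (filter_subseq _ _).
move=> k'; rewrite inE => /orP[/eqP -> l l' ls l's|]; last exact: cs'.
have := mem_subseq s's ls; have := mem_subseq s's l's; rewrite !mem_filter.
by move=> /andP[/eqP -> _] /andP[/eqP -> _].
Qed.

(** After the columns have been refined to make 2n + 1 rows constant, one of the two
    colours occurs on at least n + 1 of these rows. The bound N does not depend on
    the colouring. *)
Lemma bipartite_ramsey n p0 : exists N, forall chi, exists ks ls b,
  [/\ [/\ sorted ltn ks, size ks = n.+1 & {in ks, forall k, (p0 <= k <= N)%N}],
      [/\ sorted ltn ls, size ls = n.+1 & {in ls, forall l, (p0 <= l <= N)%N}] &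
      {in ks & ls, forall k l, chi k l = b}].
Proof.
pose r := n.*2.+1; pose c := (n.+1 * 2 ^ r)%N; exists (p0 + r + c)%N => chi.
have [|s' [s's ms' cs']] := @refine_columns chi (iota p0 r) (iota p0 c) n.+1.
  by rewrite !size_iota.
pose v k := chi k (nth 0%N s' 0).
have [b bs] : exists b, (n < size [seq k <- iota p0 r | v k == b])%N.
  have := count_predC (fun k => v k == true) (iota p0 r).
  have [h|h] := ltnP n (size [seq k <- iota p0 r | v k == true]); first by exists true.
  move=> E; exists false; move: h E; rewrite !size_filter size_iota /r.
  rewrite (eq_count (a1 := fun k => v k == false) (a2 := predC (fun k => v k == true))).
    lia.
  by move=> l /=; case: (v l).
have ss s : subseq s (iota p0 c) \/ subseq s (iota p0 r) -> sorted ltn s.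
  by move=> [|] h; apply: (subseq_sorted ltn_trans h); exact: iota_ltn_sorted.
pose ks := take n.+1 [seq k <- iota p0 r | v k == b]; pose ls := take n.+1 s'.
have ksr : subseq ks (iota p0 r).
  exact: subseq_trans (take_subseq _ _) (filter_subseq _ _).
have lsc : subseq ls (iota p0 c) by exact: subseq_trans (take_subseq _ _) s's.
exists ks, ls, b; split.
- split; [by apply: ss; right| by rewrite size_takel|].
  by move=> k /(mem_subseq ksr); rewrite mem_iota; lia.
- split; [by apply: ss; left| by rewrite size_takel|].
  by move=> k /(mem_subseq lsc); rewrite mem_iota; lia.
move=> k l /mem_take; rewrite mem_filter => /andP[/eqP vb kr] /mem_take ls'.
by rewrite -vb /v; apply: cs' => //; apply: mem_nth; exact: leq_trans ms'.
Qed.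

End Ramsey.

(** * Compression of an operator and factorization *)

Section Factor.
Variables (R : realType).

(** An operator that is close to a multiplier with entries bounded away from zero
    is bounded below, because the norm depends only on the absolute values of the
    Haar coefficients and is monotone in them. *)
Lemma H1norm_lower n (f g : H1 R n) (d : word -> word -> R) (delta : R) :
  0 <= delta ->
  (forall u v, (size u <= n)%N -> (size v <= n)%N -> 2^-1 <= `|d u v|) ->
  (forall u v, (size u <= n)%N -> (size v <= n)%N ->
     `|hcoef g u v - d u v * hcoef f u v| <= delta * H1norm f) ->
  2^-1 * H1norm f <= H1norm g + n.+1%:R * delta * H1norm f.
Proof.
move=> dl0 dge gd; rewrite (H1norm_grid_avg g (leqnn n)) [in leLHS](H1norm_grid_avg f (leqnn n)).
rewrite -grid_avgZ -[X in _ + X](grid_avg_cst n) -grid_avgD; apply: grid_avg_le => x y xn yn.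
have an (i : 'I_n.+1) z : size z = n -> (size (anc i z) <= n)%N.
  by move=> zn; rewrite size_drop; lia.
have E0 := mulr_ge0 dl0 (H1norm_ge0 f).
pose a (ij : 'I_n.+1 * 'I_n.+1) := hcoef f (anc ij.1 x) (anc ij.2 y).
pose b (ij : 'I_n.+1 * 'I_n.+1) := hcoef g (anc ij.1 x) (anc ij.2 y).
pose e (ij : 'I_n.+1 * 'I_n.+1) : R := delta * H1norm f.
pose dd (ij : 'I_n.+1 * 'I_n.+1) := d (anc ij.1 x) (anc ij.2 y).
rewrite !square_fun_l2.
have l2e : l2 e = n.+1%:R * delta * H1norm f.
  rewrite /l2 /e sumr_const card_prod !card_ord.
  rewrite -[_ *+ _]mulr_natr natrM -expr2 -exprMn sqrtr_sqr ger0_norm.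
    by rewrite mulrC mulrA.
  by rewrite mulr_ge0.
rewrite -l2e; apply: le_trans (_ : l2 (fun ij => dd ij * a ij) <= _).
  have -> : 2^-1 * l2 a = l2 (fun ij => 2^-1 * a ij).
    rewrite /l2; under [in RHS]eq_bigr do rewrite exprMn.
    by rewrite -mulr_sumr sqrtrM ?sqr_ge0// sqrtr_sqr ger0_norm.
  apply: l2_le => -[i j]; rewrite !normrM ler_wpM2r// ger0_norm// /dd.
  by apply: dge; exact: an.
apply: le_trans (_ : l2 (fun ij => b ij + (dd ij * a ij - b ij)) <= _).
  rewrite le_eqVlt; apply/orP; left; apply/eqP; congr Num.sqrt.
  by apply: eq_bigr => ij _; rewrite addrC subrK.
apply: le_trans (l2D _ _) _; rewrite lerD2l; apply: l2_le => -[i j].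
rewrite [leRHS]ger0_norm// distrC; apply: gd; exact: an.
Qed.

Variables (N n : nat) (M q : R) (T : {linear H1 R N -> H1 R N}).

(** The scalar product of T h_{KxL} with h_{K'xL'}. *)
Definition mx_entry (K L K' L' : word) : R :=
  hcoef (T (haar_elt R N K L)) K' L' * (2 ^- size K' * 2 ^- size L').

Variables (ks ls : seq nat) (om om' : signs N).
Hypotheses (gk : admissible N n q ks) (gl : admissible N n q ls).

Lemma hcoef_compression (f : H1 R n) I' J' : (size I' <= n)%N -> (size J' <= n)%N ->
  hcoef (block_prj n ks ls om om' (T (block_emb ks ls om om' f))) I' J' =
  2 ^+ size I' * 2 ^+ size J' * \sum_(I <- wordsle n) \sum_(J <- wordsle n)
    hcoef f I J * pairing mx_entry ks ls om om' I J I' J'.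
Proof.
move=> I'n J'n; rewrite hcoef_of_coefs// /block_prj_coef; congr (_ * _).
transitivity (\sum_(K' <- words (level ks (size I'))) \sum_(L' <- words (level ls (size J')))
  \sum_(I <- wordsle n) \sum_(J <- wordsle n) hcoef f I J *
    \sum_(K <- words (level ks (size I))) \sum_(L <- words (level ls (size J)))
      blk ks R om I K * (blk ls R om' J L *
       (blk ks R om I' K' * blk ls R om' J' L' * mx_entry K L K' L'))).
  apply: eq_bigr => K' _; apply: eq_bigr => L' _.
  rewrite -(sum_block_emb2 om om' gk gl f (fun K L =>
     blk ks R om I' K' * blk ls R om' J' L' * mx_entry K L K' L')).
  rewrite hcoef_linear !mulr_sumr; apply: eq_bigr => K _.
  rewrite !mulr_sumr; apply: eq_bigr => L _; rewrite /mx_entry.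
  set x := 2 ^- size K'; set y := 2 ^- size L'; ring.
under eq_bigr do rewrite exchange_big/=.
rewrite exchange_big/=; apply: eq_bigr => I _.
under eq_bigr do rewrite exchange_big/=.
rewrite exchange_big/=; apply: eq_bigr => J _.
under eq_bigr do rewrite -mulr_sumr.
rewrite -mulr_sumr /pairing; congr (_ * _).
under eq_bigr do rewrite exchange_big/=.
rewrite exchange_big/=; apply: eq_bigr => K _; apply: eq_bigr => K' _.
rewrite exchange_big/= mulr_sumr; apply: eq_bigr => L _.
rewrite mulr_sumr; apply: eq_bigr => L' _; ring.
Qed.

(** The constant collects the factor 4^n from the normalization of the projection,
    another 4^n from the bound of the coefficients by the norm, and the number of
    terms. *)
Lemma compression_near_diag eps (f : H1 R n) I' J' : 0 <= eps ->
  (forall I J I' J', (size I <= n)%N -> (size J <= n)%N ->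
  (size I' <= n)%N -> (size J' <= n)%N ->
  `|pairing_err mx_entry ks ls om om' I J I' J'| <= eps) ->
  (size I' <= n)%N -> (size J' <= n)%N ->
  `|hcoef (block_prj n ks ls om om' (T (block_emb ks ls om om' f))) I' J' -
    diagsum mx_entry (level ks (size I')) (level ls (size J')) * hcoef f I' J'| <=
  (2 ^+ n) ^+ 4 * (size (wordsle n))%:R ^+ 2 * eps * H1norm f.
Proof.
move=> e0 errP I'n J'n; rewrite hcoef_compression//.
set D := diagsum _ _ _; pose s : R := 2 ^+ size I' * 2 ^+ size J'.
have n0 i : 2 ^+ i != 0 :> R by rewrite expf_neq0// pnatr_eq0.
have sE : \sum_(I <- wordsle n) \sum_(J <- wordsle n)
    hcoef f I J * pairing mx_entry ks ls om om' I J I' J' =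
   \sum_(I <- wordsle n) \sum_(J <- wordsle n)
    hcoef f I J * pairing_err mx_entry ks ls om om' I J I' J' + s^-1 * (D * hcoef f I' J').
  have -> : s^-1 * (D * hcoef f I' J') = \sum_(I <- wordsle n) \sum_(J <- wordsle n)
      (if I == I' then if J == J' then s^-1 * (D * hcoef f I J) else 0 else 0).
    rewrite -[LHS](sum_wordsle_pick (fun I => s^-1 * (D * hcoef f I J')) I'n).
    apply: eq_bigr => I _; case: eqP => _; last by rewrite big1.
    by rewrite (sum_wordsle_pick (fun J => s^-1 * (D * hcoef f I J)) J'n).
  rewrite -big_split/=; apply: eq_bigr => I _; rewrite -big_split/=.
  apply: eq_bigr => J _; rewrite /pairing_err.
  case: eqP => [->|_]; last by rewrite mul0r subr0 addr0.
  case: eqP => [->|_]; last by rewrite mul0r mulr0 subr0 addr0.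
  by rewrite !mul1r /D /s invfM; set x := (2 ^+ size I')^-1; set y := (2 ^+ size J')^-1; ring.
rewrite sE mulrDr -/s mulrA divff ?mul1r ?addrK; last by rewrite /s mulf_neq0.
have p1 i : (i <= n)%N -> 2 ^+ i <= 2 ^+ n :> R by move=> iN; rewrite ler_weXn2l// ler1n.
have p0 i : 0 <= 2 ^+ i :> R by rewrite exprn_ge0.
have H0 := H1norm_ge0 f.
have sle : s <= 2 ^+ n * 2 ^+ n by rewrite ler_pM ?p1.
rewrite normrM ger0_norm ?mulr_ge0//.
apply: (@le_trans _ _ (2 ^+ n * 2 ^+ n * \sum_(I <- wordsle n) \sum_(J <- wordsle n)
   (2 ^+ n * 2 ^+ n * H1norm f * eps))).
  rewrite ler_pM ?mulr_ge0//.
  apply: le_trans (ler_norm_sum _ _ _) _; apply: ler_sum_seq => I; rewrite mem_wordsle => In.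
  apply: le_trans (ler_norm_sum _ _ _) _; apply: ler_sum_seq => J; rewrite mem_wordsle => Jn.
  rewrite normrM ler_pM ?errP//; apply: le_trans (hcoef_le f In Jn) _.
  by rewrite ler_wpM2r// ler_pM ?p1.
have cst (c : R) : \sum_(I <- wordsle n) c = (size (wordsle n))%:R * c.
  by rewrite big_const_seq count_predT iter_addr_0 -[_ *+ _]mulr_natr mulrC.
rewrite !cst le_eqVlt; apply/orP; left; apply/eqP; ring.
Qed.

End Factor.

Theorem theorem3p1 (R : realType) :
  exists2 C : R, 0 < C &
  forall (n : nat) (M : R), (0 < n)%N -> 0 < M ->
  exists2 N : nat, (0 < N)%N &
  forall T : {linear H1 R N -> H1 R N}, (opnorm T <= M%:E)%E ->
  exists2 H : H1 R N -> H1 R N, H = T \/ H = idfun \- T &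
  exists (E : {linear H1 R n -> H1 R N}) (P : {linear H1 R N -> H1 R n}),
    P \o H \o E = idfun /\ (opnorm E * opnorm P <= C%:E)%E.
Proof.
exists 4 => // n M n0 M0.
(* [delta] makes the perturbation, at most (n + 1) delta, equal to 1/4, half of the
   lower bound 1/2 of the diagonal; [eps] and [q] are what the previous lemmas then
   require of the pairings and of the levels *)
pose w : R := (size (wordsle n))%:R.
have w0 : 0 < w.
  by rewrite ltr0n lt0n size_eq0; apply/eqP => E; have := mem_wordsle n [::]; rewrite E.
pose delta : R := (4 * n.+1%:R)^-1.
have d0 : 0 < delta by rewrite invr_gt0 mulr_gt0// ltr0n.
pose eps : R := delta / ((2 ^+ n) ^+ 4 * w ^+ 2).
have e0 : 0 < eps by rewrite divr_gt0// mulr_gt0 ?exprn_gt0.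
pose q : R := eps ^+ 2 / (w ^+ 4 * (40 * M ^+ 2)) / 2.
have q0 : 0 < q by rewrite /q !divr_gt0 ?exprn_gt0// !mulr_gt0 ?exprn_gt0.
have small : w ^+ 4 * (40 * (M ^+ 2 * q)) < eps ^+ 2.
  have -> : w ^+ 4 * (40 * (M ^+ 2 * q)) = eps ^+ 2 / 2.
    by rewrite /q; field; rewrite !gt_eqF.
  by have := exprn_gt0 2 e0; lra.
have [p0 p0q] : exists p0, forall k, (p0 <= k)%N -> 2 ^- k <= q.
  exists (Num.Def.archi_bound q^-1) => k kp.
  rewrite -[leRHS]invrK lef_pV2 ?posrE ?invr_gt0 ?exprn_gt0//.
  by apply/ltW/upper_nthrootP.
have [N ramsey] := bipartite_ramsey n p0.
exists N.+1 => // T TM.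
have trow := matrix_row_bound TM.
pose t := mx_entry T.
have [ks [ls [b [[kss ksz kp] [lss lsz lp] chib]]]] :=
  ramsey (fun k l => 2^-1 <= diagsum t k l).
have gk : admissible N.+1 n q ks.
  by split=> // k /kp/andP[kp0 kN]; [exact: leqW|exact: p0q].
have gl : admissible N.+1 n q ls.
  by split=> // k /lp/andP[kp0 kN]; [exact: leqW|exact: p0q].
have [om [om' errP]] := exists_good_signs (ltW M0) (ltW q0) trow gk gl e0 small.
pose E : {linear H1 R n -> H1 R N.+1} := block_emb ks ls om om'.
pose P : {linear H1 R N.+1 -> H1 R n} := block_prj n ks ls om om'.
have nearD (f : H1 R n) I J : (size I <= n)%N -> (size J <= n)%N ->
    `|hcoef (P (T (E f))) I J - diagsum t (level ks (size I)) (level ls (size J)) * hcoef f I J|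
    <= delta * H1norm f.
  move=> In Jn; apply: le_trans (compression_near_diag gk gl f (ltW e0) errP In Jn) _.
  rewrite ler_wpM2r ?H1norm_ge0// le_eqVlt; apply/orP; left; apply/eqP.
  by rewrite -/w /eps; field; rewrite !gt_eqF ?exprn_gt0.
have [H [HT lower]] : exists H : {linear H1 R N.+1 -> H1 R N.+1},
    ((H : H1 R N.+1 -> H1 R N.+1) = T \/ (H : H1 R N.+1 -> H1 R N.+1) = idfun \- T) /\
    forall f : H1 R n, H1norm f <= 4 * H1norm (P (H (E f))).
  have fin (f g : H1 R n) : 2^-1 * H1norm f <= H1norm g + n.+1%:R * delta * H1norm f ->
      H1norm f <= 4 * H1norm (g : H1 R n).
    have -> : n.+1%:R * delta = 4^-1 by rewrite /delta invfM mulrCA divff ?mulr1// pnatr_eq0.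
    by move: (H1norm f) (H1norm g); clear => F G; lra.
  have km (I : word) : (size I <= n)%N -> level ks (size I) \in ks by exact: level_mem gk.
  have lm (I : word) : (size I <= n)%N -> level ls (size I) \in ls by exact: level_mem gl.
  case: b chib => chib.
    exists T; split=> [|f]; first by left.
    apply: fin; apply: (H1norm_lower (ltW d0) _ (nearD f)) => I J In Jn.
    have := chib _ _ (km _ In) (lm _ Jn) => /= h.
    by apply: le_trans h (ler_norm _).
  exists (idfun \- T); split=> [|f]; first by right.
  apply: fin.
  apply: (H1norm_lower (d := fun I J => 1 - diagsum t (level ks (size I)) (level ls (size J))) (ltW d0)).
    move=> I J In Jn; have := chib _ _ (km _ In) (lm _ Jn) => /= /negbT.
    rewrite -ltNge => h; apply: le_trans (ler_norm _).
    by move: h; move: (diagsum _ _ _); clear => D; lra.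
  have PHE : P ((idfun \- T) (E f)) = f - P (T (E f)).
    transitivity (P (E f - T (E f))) => //.
    by rewrite linearB; congr (_ - _); exact: (block_prj_emb _ _ gk gl).
  move=> I J In Jn; rewrite PHE hcoefB.
  have := nearD f I J In Jn; rewrite distrC; apply: le_trans.
  by rewrite le_eqVlt; apply/orP; left; apply/eqP; congr `|_|; ring.
have [S' [S'K KS']] : exists S' : {linear H1 R n -> H1 R n},
    cancel (P \o H \o E) S' /\ cancel S' (P \o H \o E).
  apply: (injective_linear_inverse (S := (P \o H \o E : {linear H1 R n -> H1 R n}))) => f Sf.
  apply: H1norm_eq0; apply/eqP; rewrite eq_le H1norm_ge0 andbT.
  have := lower f; rewrite -[P (H (E f))]/((P \o H \o E) f) Sf.
  by rewrite -(scale0r (0 : H1 R n)) H1normZ normr0 mul0r mulr0.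
exists H => //; exists E, (S' \o P : {linear H1 R N.+1 -> H1 R n}); split.
  apply/funext => f; exact: S'K.
have oE : (opnorm E <= 1%:E)%E.
  by apply: opnorm_le => f f1; rewrite (H1norm_block_emb _ _ gk gl).
have oP : (opnorm (S' \o P) <= 4%:E)%E.
  apply: opnorm_le => g g1; apply: le_trans (lower ((S' \o P) g)) _.
  have -> : P (H (E ((S' \o P) g))) = P g by exact: KS'.
  have Pg1 : H1norm (P g) <= 1 by exact: le_trans (H1norm_block_prj _ _ gk gl g) g1.
  by move: Pg1; move: (H1norm (P g)); clear => x; lra.
apply: (@le_trans _ _ (1%:E * 4%:E)%E); last by rewrite mul1e.
by apply: lee_pmul => //; exact: opnorm_ge0.
Qed.
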